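(* Let $(X,\Sigma,\mu)$ be a complete $\sigma$-finite measure space. Let $\Xi=(X_n)$ be an increasing sequence (with respect to inclusion) of measurable sets with positive measure such that $X=\bigcup X_n$. Let $1\le p<\infty$ and $1\le q\le\infty$ satisfy $\frac1p+\frac1q=1$. For every $n\in\mathbb{N}$, let $T_n:\mathrm{L}^q(X_n)\to\mathrm{L}^p(X_n)^\sim$ be the usual (isometric) lattice isomorphism $$T_n(u)(v)=\int_{X_n}uv\,d\mu,\quad u\in\mathrm{L}^q(X_n),\ v\in\mathrm{L}^p(X_n).$$ There exists a unique lattice isomorphism $R:\mathrm{L}^q_{\Xi-c}(X)\to\mathrm{L}^p_{\Xi-\ell oc}(X)^\sim$ such that $R\circ e_n=r_n^\sim\circ T_n$ for every $n\in\mathbb{N}$.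
   Context: $\mathrm{E}^\sim$ is the order dual of a vector lattice $\mathrm{E}$ (order bounded linear functionals), and for a positive operator $S:\mathrm{E}\to\mathrm{F}$, $S^\sim:\mathrm{F}^\sim\to\mathrm{E}^\sim$ is $\varphi\mapsto\varphi\circ S$. $\mathrm{L}^q_{\Xi-c}(X)=\{u\in\mathrm{L}^q(X): u=0 \text{ a.e. on } X\setminus X_n \text{ for some } n\in\mathbb{N}\}$, and $e_n:\mathrm{L}^q(X_n)\to\mathrm{L}^q_{\Xi-c}(X)$ is extension by $0$ outside $X_n$. $\mathrm{L}^p_{\Xi-\ell oc}(X)$ is the vector lattice of (equivalence classes of) measurable functions $u:X\to\mathbb{R}$ such that $u\mathbf{1}_{X_n}\in\mathrm{L}^p(X_n)$ for every $n\in\mathbb{N}$, and $r_n:\mathrm{L}^p_{\Xi-\ell oc}(X)\to\mathrm{L}^p(X_n)$ is restriction to $X_n$. *)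

(* Defs.v *)
From HB Require Import structures.
From mathcomp Require Import all_boot all_order all_algebra.
From mathcomp Require Import all_classical all_reals all_analysis.
From mathcomp Require Import measurable_realfun ess_sup_inf.
From mathcomp Require Import ring.

Set Implicit Arguments.
Unset Strict Implicit.
Unset Printing Implicit Defensive.
Import Order.TTheory GRing.Theory Num.Theory.
Import numFieldNormedType.Exports.
Local Open Scope classical_set_scope.
Local Open Scope ring_scope.

(* Vector lattices (Riesz spaces). The lattice operations are fields of the
   mixin instead of coming from Order.Lattice: the join of Order.Lattice and
   GRing.Zmodule is not available in the hierarchy below Num.RealDomain. *)

HB.mixin Record Lmodule_isVectorLattice (R : realType) E
    of GRing.Lmodule R E & Num.POrderedZmodule E := {
  vl_join : E -> E -> E;
  vl_meet : E -> E -> E;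
  vl_joinP : forall x y z : E, (vl_join x y <= z) = (x <= z) && (y <= z);
  vl_meetP : forall x y z : E, (z <= vl_meet x y) = (z <= x) && (z <= y);
  vl_lerD2r : forall x y z : E, x <= y -> x + z <= y + z;
  vl_lerZ2l : forall (a : R) (x y : E), 0 <= a -> x <= y -> a *: x <= a *: y
}.

#[short(type="vectorLatticeType")]
HB.structure Definition VectorLattice (R : realType) :=
  { E of GRing.Lmodule R E & Num.POrderedZmodule E &
         Lmodule_isVectorLattice R E }.

Section vector_lattice_theory.
Context (R : realType) (E : vectorLatticeType R).
Implicit Types (x y z : E) (a : R).

Lemma vl_leUl x y : x <= vl_join x y.
Proof. by have := vl_joinP x y (vl_join x y); rewrite lexx => /esym/andP[]. Qed.

Lemma vl_leUr x y : y <= vl_join x y.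
Proof. by have := vl_joinP x y (vl_join x y); rewrite lexx => /esym/andP[]. Qed.

Lemma vl_leIl x y : vl_meet x y <= x.
Proof. by have := vl_meetP x y (vl_meet x y); rewrite lexx => /esym/andP[]. Qed.

Lemma vl_leIr x y : vl_meet x y <= y.
Proof. by have := vl_meetP x y (vl_meet x y); rewrite lexx => /esym/andP[]. Qed.

Lemma vl_leD2r z x y : (x + z <= y + z) = (x <= y).
Proof.
apply/idP/idP => [/(@vl_lerD2r _ _ _ _ (- z))|]; last exact: vl_lerD2r.
by rewrite !addrK.
Qed.

Lemma vl_leD2l z x y : (z + x <= z + y) = (x <= y).
Proof. by rewrite ![z + _]addrC vl_leD2r. Qed.

Lemma vl_leD x y z t : x <= y -> z <= t -> x + z <= y + t.
Proof.
by move=> xy zt; apply: (@le_trans _ _ (y + z)); rewrite ?vl_leD2r ?vl_leD2l.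
Qed.

Lemma vl_subr_ge0 x y : (0 <= y - x) = (x <= y).
Proof. by rewrite -[LHS](vl_leD2r x) add0r subrK. Qed.

Lemma vl_leN2 x y : (- x <= - y) = (y <= x).
Proof. by rewrite -[LHS](vl_leD2r (x + y)) addKr addrCA addNr addr0. Qed.

Lemma vl_scaler_ge0 a x : 0 <= a -> 0 <= x -> 0 <= a *: x.
Proof. by move=> a0 x0; rewrite -(scaler0 _ a); exact: vl_lerZ2l. Qed.

Lemma vl_addr_ge0 x y : 0 <= x -> 0 <= y -> 0 <= x + y.
Proof. by move=> x0 y0; rewrite -[0]addr0; exact: vl_leD. Qed.

Definition vl_pos x : E := vl_join x 0.

Lemma vl_pos_ge0 x : 0 <= vl_pos x.
Proof. exact: vl_leUr. Qed.

Lemma vl_pos_id x : 0 <= x -> vl_pos x = x.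
Proof. by move=> x0; by apply/le_anti; rewrite vl_joinP lexx x0 vl_leUl. Qed.

Lemma vl_posB x : vl_pos x - vl_pos (- x) = x.
Proof.
suff -> : vl_pos (- x) = vl_pos x - x by rewrite opprB addrC subrK.
apply/le_anti/andP; split.
- rewrite vl_joinP -[X in X <= _]add0r vl_leD2r vl_pos_ge0 vl_subr_ge0.
  exact: vl_leUl.
- rewrite -(vl_leD2r x) subrK vl_joinP -[X in X <= _]add0r vl_leD2r vl_leUr.
  by rewrite -[0](addNr x) vl_leD2r vl_leUl.
Qed.

Lemma riesz_decomposition x y z : 0 <= x -> 0 <= y -> 0 <= z -> z <= x + y ->
  exists u v, [/\ z = u + v, 0 <= u <= x & 0 <= v <= y].
Proof.
move=> x0 y0 z0 zxy; exists (vl_meet z x), (z - vl_meet z x).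
split; first by rewrite addrC subrK.
  by rewrite vl_meetP z0 x0 vl_leIr.
have h : z - y <= vl_meet z x.
  rewrite vl_meetP; apply/andP; split.
    by rewrite -[X in _ <= X]addr0 vl_leD2l -oppr0 vl_leN2.
  by rewrite -(vl_leD2r y) subrK.
rewrite vl_subr_ge0 vl_leIl/=; move: h.
by rewrite -(vl_leD2r (y - vl_meet z x)) subrKA [vl_meet z x + _]addrC subrK.
Qed.

Lemma vl_meetE x y : vl_meet x y = x + y - vl_join x y.
Proof.
apply/le_anti/andP; split.
  rewrite -(vl_leD2r (vl_join x y - vl_meet x y)) [X in X <= _]addrC subrK.
  rewrite subrKA vl_joinP; apply/andP; split.
    by rewrite -[X in X <= _](addrK y x) vl_leD2l vl_leN2 vl_leIr.
  by rewrite -[X in X <= _](addrK x y) [y + x]addrC vl_leD2l vl_leN2 vl_leIl.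
rewrite vl_meetP; apply/andP; split.
  by rewrite -[X in _ <= X](addrK y x) vl_leD2l vl_leN2 vl_leUr.
by rewrite -[X in _ <= X](addrK x y) [y + x]addrC vl_leD2l vl_leN2 vl_leUl.
Qed.

End vector_lattice_theory.

HB.factory Record SubChoice_isSubVectorLattice (R : realType)
    (E : vectorLatticeType R) (S : pred E) U of SubChoice E S U := {
  svl_submod : submod_closed S;
  svl_join : forall x y, x \in S -> y \in S -> vl_join x y \in S
}.

HB.builders Context (R : realType) (E : vectorLatticeType R) (S : pred E) U
  of SubChoice_isSubVectorLattice R E S U.

HB.instance Definition _ := GRing.isSubmodClosed.Build R E S svl_submod.
HB.instance Definition _ := GRing.SubChoice_isSubLmodule.Build R E S U svl_submod.

Let le (x y : U) := (val x <= val y).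
Let le_refl' : reflexive le. Proof. by move=> x; exact: lexx. Qed.
Let le_anti' : antisymmetric le.
Proof. by move=> x y xy; apply/val_inj/le_anti. Qed.
Let le_trans' : transitive le.
Proof. by move=> y x z; exact: le_trans. Qed.
HB.instance Definition _ := Order.Le_isPOrder.Build ring_display U
  le_refl' le_anti' le_trans'.

Let join (x y : U) : U := Sub (vl_join (val x) (val y)) (svl_join (valP x) (valP y)).
Let meet (x y : U) : U := x + y - join x y.

Let leE (x y : U) : (x <= y) = (val x <= val y). Proof. by []. Qed.

Let joinP (x y z : U) : (join x y <= z) = (x <= z) && (y <= z).
Proof. by rewrite !leE SubK vl_joinP. Qed.

Let meetP (x y z : U) : (z <= meet x y) = (z <= x) && (z <= y).
Proof. by rewrite !leE raddfB raddfD/= SubK -vl_meetE vl_meetP. Qed.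

Let lerD2r (x y z : U) : x <= y -> x + z <= y + z.
Proof. by rewrite !leE !raddfD; exact: vl_lerD2r. Qed.

Let lerZ2l (a : R) (x y : U) : 0 <= a -> x <= y -> a *: x <= a *: y.
Proof. by rewrite !leE !linearZ; exact: vl_lerZ2l. Qed.

HB.instance Definition _ := Lmodule_isVectorLattice.Build R U
  joinP meetP lerD2r lerZ2l.

HB.end.

Section operators.
Context (R : realType) (E F : vectorLatticeType R).

Definition positive_operator (S : E -> F) :=
  linear S /\ forall x, 0 <= x -> 0 <= S x.

Definition lattice_isomorphism (S : E -> F) :=
  [/\ linear S, bijective S, {morph S : x y / vl_join x y}
    & {morph S : x y / vl_meet x y}].

End operators.

Section order_dual.
Context (R : realType) (E : vectorLatticeType R).
Implicit Types (f g h : E -> R^o).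

(* bounded on order intervals *)
Definition order_bounded f :=
  forall a b : E, exists M : R, forall x, a <= x <= b -> `|f x| <= M.

Definition order_dual_pred : {pred E -> R^o} :=
  mem [set f | linear f /\ order_bounded f].

Record order_dual := OrderDual {
  order_dual_fun :> E -> R^o ;
  order_dual_funP : order_dual_fun \in order_dual_pred }.

HB.instance Definition _ := [isSub for order_dual_fun].
HB.instance Definition _ := [Choice of order_dual by <:].

Lemma order_dual_submod_closed : submod_closed order_dual_pred.
Proof.
split.
  rewrite inE; split=> [a x y|a b]; first by rewrite /= scaler0 addr0.
  by exists 0 => x _; rewrite normr0.
move=> c f g; rewrite !inE => -[lf bf] [lg bg]; split.
  move=> a x y; have fgE z : (c *: f + g) z = c * f z + g z :> R by [].
  transitivity (c * (a * f x + f y) + (a * g x + g y) : R).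
    by rewrite fgE lf lg.
  transitivity (a * (c * f x + g x) + (c * f y + g y) : R) => //; ring.
move=> a b; have [M fM] := bf a b; have [N gN] := bg a b.
exists (`|c| * M + N) => x xab; rewrite (le_trans (ler_normD _ _))// lerD ?gN//.
by rewrite normrM ler_wpM2l ?fM.
Qed.

HB.instance Definition _ := GRing.isSubmodClosed.Build _ _ order_dual_pred
  order_dual_submod_closed.
HB.instance Definition _ := [SubChoice_isSubLmodule of order_dual by <:].

Lemma order_dual_linear (f : order_dual) : linear f.
Proof. by have := valP f; rewrite inE => -[]. Qed.

Lemma order_dual_bounded (f : order_dual) : order_bounded f.
Proof. by have := valP f; rewrite inE => -[]. Qed.
Arguments order_dual_linear : clear implicits.

Lemma order_dualD (f g : order_dual) x : (f + g) x = f x + g x.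
Proof. by []. Qed.

Lemma order_dualN (f : order_dual) x : (- f) x = - f x.
Proof. by []. Qed.

Lemma order_dualZ a (f : order_dual) x : (a *: f) x = a * f x.
Proof. by []. Qed.

Section linear_functional.
Variables (f : E -> R^o) (lf : linear f).

Lemma lfunD x y : f (x + y) = f x + f y.
Proof. by rewrite -[x in LHS]scale1r lf scale1r. Qed.
Lemma lfun0 : f 0 = 0.
Proof. by apply: (addrI (f 0)); rewrite -lfunD !addr0. Qed.
Lemma lfunZ a x : f (a *: x) = a * f x.
Proof. by rewrite -[a *: x]addr0 lf lfun0 addr0. Qed.
Lemma lfunN x : f (- x) = - f x.
Proof. by apply: (addrI (f x)); rewrite -lfunD !subrr lfun0. Qed.
Lemma lfunB x y : f (x - y) = f x - f y.
Proof. by rewrite lfunD lfunN. Qed.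
End linear_functional.

Lemma pos_order_bounded f : linear f -> (forall x, 0 <= x -> 0 <= f x) ->
  order_bounded f.
Proof.
move=> lf f0 a b; exists (`|f a| + `|f b|) => x /andP[ax xb].
have : f a <= f x by rewrite -subr_ge0 -lfunB// f0// vl_subr_ge0.
have : f x <= f b by rewrite -subr_ge0 -lfunB// f0// vl_subr_ge0.
move=> h1 h2; rewrite ler_norml; apply/andP; split.
  apply: le_trans h2; rewrite lerNl (le_trans _ (_ : `|f a| <= _))//.
    by rewrite -normrN ler_norm.
  by rewrite lerDl.
by apply: (le_trans h1); apply: (le_trans (ler_norm _)); rewrite lerDr.
Qed.

(* f <= g iff g - f is a positive functional *)
Definition order_dual_le (f g : order_dual) :=
  `[< forall x, 0 <= x -> (f x : R) <= g x >].

Lemma order_dualP (f g : order_dual) :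
  (forall x, 0 <= x -> f x = g x) -> f = g.
Proof.
move=> fg; apply/val_inj/funext => x /=; rewrite -(vl_posB x).
by rewrite !lfunB ?fg ?vl_pos_ge0//; exact: order_dual_linear.
Qed.

Let od_le_refl : reflexive order_dual_le.
Proof. by move=> f; apply/asboolP. Qed.

Let od_le_anti : antisymmetric order_dual_le.
Proof.
move=> f g /andP[/asboolP fg /asboolP gf]; apply: order_dualP => x x0.
by apply/le_anti; rewrite fg// gf.
Qed.

Let od_le_trans : transitive order_dual_le.
Proof.
move=> g f h /asboolP fg /asboolP gh; apply/asboolP => x x0.
exact: le_trans (fg x x0) (gh x x0).
Qed.

HB.instance Definition _ := Order.Le_isPOrder.Build ring_display order_dual
  od_le_refl od_le_anti od_le_trans.

Lemma order_dual_leP (f g : order_dual) :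
  reflect (forall x, 0 <= x -> (f x : R) <= g x) (f <= g).
Proof. exact: asboolP. Qed.

(* The Riesz-Kantorovich formula for the positive part of a functional *)
Section riesz_kantorovich.
Variable f : order_dual.
Let lf := order_dual_linear f.

Definition rk_set x : set R := [set (f y : R) | y in [set y | 0 <= y <= x]].
Definition rk_sup x : R := sup (rk_set x).
Definition rk_pos x : R := rk_sup (vl_pos x) - rk_sup (vl_pos (- x)).

Lemma rk_has_sup x : 0 <= x -> has_sup (rk_set x).
Proof.
move=> x0; split; first by exists (f 0), 0 => //=; rewrite lexx.
have [M fM] := order_dual_bounded f 0 x.
by exists M => _ [y /fM fy <-]; exact: le_trans (ler_norm _) fy.
Qed.

Lemma rk_ub x y : 0 <= x -> 0 <= y <= x -> (f y : R) <= rk_sup x.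
Proof.
by move=> x0 y0x; apply: ub_le_sup; [exact: (rk_has_sup x0).2 | exists y].
Qed.

Lemma rk_lub x (M : R) : 0 <= x -> (forall y, 0 <= y <= x -> (f y : R) <= M) ->
  rk_sup x <= M.
Proof.
move=> x0 fM; apply: ge_sup; first exact: (rk_has_sup x0).1.
by move=> _ [y /fM ? <-].
Qed.

Lemma rk_sup_ge0 x : 0 <= x -> 0 <= rk_sup x.
Proof. by move=> x0; rewrite -(lfun0 lf) rk_ub// lexx. Qed.

Lemma rk_supD x y : 0 <= x -> 0 <= y -> rk_sup (x + y) = rk_sup x + rk_sup y.
Proof.
move=> x0 y0; have xy0 := vl_addr_ge0 x0 y0; apply/le_anti/andP; split.
  apply: rk_lub => // z /andP[z0 zxy].
  have [u [v [-> ux vy]]] := riesz_decomposition x0 y0 z0 zxy.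
  by rewrite lfunD// lerD// rk_ub.
rewrite -lerBrDr; apply: rk_lub => // u /andP[u0 ux].
rewrite lerBrDr -lerBrDl; apply: rk_lub => // v /andP[v0 vy].
by rewrite lerBrDl -lfunD// rk_ub// vl_addr_ge0// vl_leD.
Qed.

Lemma rk_supZ (a : R) x : 0 <= a -> 0 <= x -> rk_sup (a *: x) = a * rk_sup x.
Proof.
move=> a0 x0; have [->|a1] := eqVneq a 0.
  rewrite scale0r mul0r; apply/le_anti; rewrite rk_sup_ge0// andbT.
  apply: rk_lub => // y y0; have -> : y = 0 by apply/le_anti; rewrite andbC.
  by rewrite lfun0.
have {a1} a_gt0 : 0 < a by rewrite lt_def a1.
have ax0 : 0 <= a *: x by exact: vl_scaler_ge0.
apply/le_anti/andP; split.
  apply: rk_lub => // y /andP[y0 yx].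
  rewrite -ler_pdivrMl// -lfunZ// rk_ub// vl_scaler_ge0 ?invr_ge0//=.
  rewrite -[leRHS]scale1r -(mulVf (lt0r_neq0 a_gt0)).
  by rewrite -scalerA vl_lerZ2l// invr_ge0.
rewrite -ler_pdivlMl//; apply: rk_lub => // y /andP[y0 yx].
by rewrite ler_pdivlMl// -lfunZ// rk_ub// vl_scaler_ge0//= vl_lerZ2l.
Qed.

Lemma rk_pos_sub x y : 0 <= x -> 0 <= y -> rk_pos (x - y) = rk_sup x - rk_sup y.
Proof.
move=> x0 y0; have e : x + vl_pos (- (x - y)) = vl_pos (x - y) + y.
  by rewrite -[in RHS](subrK (vl_pos (- (x - y))) (vl_pos _)) vl_posB addrAC subrK.
apply/eqP; rewrite /rk_pos subr_eq addrAC eq_sym subr_eq.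
by rewrite -!rk_supD ?vl_pos_ge0// e.
Qed.

Lemma rk_pos_linear : linear (rk_pos : E -> R^o).
Proof.
have posD x y : rk_pos (x + y) = rk_pos x + rk_pos y.
  rewrite -[in LHS](vl_posB x) -[in LHS](vl_posB y) addrACA -opprD.
  rewrite rk_pos_sub ?vl_addr_ge0 ?vl_pos_ge0// !rk_supD ?vl_pos_ge0//.
  by rewrite opprD addrACA.
have posN x : rk_pos (- x) = - rk_pos x.
  by rewrite /rk_pos opprK opprB.
have posZ a x : 0 <= a -> rk_pos (a *: x) = a * rk_pos x.
  move=> a0; rewrite -[in LHS](vl_posB x) scalerBr.
  by rewrite rk_pos_sub ?vl_scaler_ge0 ?vl_pos_ge0// !rk_supZ ?vl_pos_ge0// mulrBr.
move=> a x y; rewrite posD; congr (_ + _).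
have [a0|/ltW a0] := leP 0 a; first exact: posZ.
by rewrite -[a in LHS]opprK scaleNr posN posZ ?oppr_ge0// mulNr opprK.
Qed.

Lemma rk_posE x : 0 <= x -> rk_pos x = rk_sup x.
Proof.
move=> x0; rewrite -[x in LHS]subr0 rk_pos_sub//.
suff -> : rk_sup 0 = 0 by rewrite subr0.
by rewrite -(scale0r 0) rk_supZ// mul0r.
Qed.

Lemma rk_pos_subproof : (rk_pos : E -> R^o) \in order_dual_pred.
Proof.
rewrite inE; split; first exact: rk_pos_linear.
apply: pos_order_bounded; first exact: rk_pos_linear.
by move=> x x0; rewrite rk_posE// rk_sup_ge0.
Qed.

Definition order_dual_pos := OrderDual rk_pos_subproof.

End riesz_kantorovich.

Lemma order_dual_pos_le (f g : order_dual) :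
  (order_dual_pos f <= g) = (f <= g) && (0 <= g).
Proof.
apply/order_dual_leP/andP => [fg|[/order_dual_leP fg /order_dual_leP g0] x x0].
  split; apply/order_dual_leP => x x0; apply: le_trans (fg _ x0).
    by rewrite /= rk_posE// rk_ub// x0 lexx.
  by rewrite /= rk_posE// rk_sup_ge0.
rewrite /= rk_posE//; apply: rk_lub => // y /andP[y0 yx].
rewrite (le_trans (fg _ y0))// -subr_ge0 -lfunB ?g0 ?vl_subr_ge0//.
exact: order_dual_linear.
Qed.

Lemma order_dual_leD2r (h f g : order_dual) : (f + h <= g + h) = (f <= g).
Proof.
by apply/order_dual_leP/order_dual_leP => fg x /fg; rewrite !order_dualD lerD2r.
Qed.

Definition order_dual_join (f g : order_dual) := order_dual_pos (f - g) + g.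
Definition order_dual_meet (f g : order_dual) := f + g - order_dual_join f g.

Let joinP (f g h : order_dual) : (order_dual_join f g <= h) = (f <= h) && (g <= h).
Proof.
rewrite -[LHS](order_dual_leD2r (- g)) addrK order_dual_pos_le.
by rewrite order_dual_leD2r -[X in _ && X](order_dual_leD2r g) add0r subrK.
Qed.

Let meetP (f g h : order_dual) : (h <= order_dual_meet f g) = (h <= f) && (h <= g).
Proof.
rewrite -[LHS](order_dual_leD2r (order_dual_join f g - h)) subrKA.
rewrite [h + _]addrC subrK joinP andbC.
rewrite -[h <= f](order_dual_leD2r (g - h)).
rewrite -[h <= g](order_dual_leD2r (f - h)).
by rewrite ![h + _]addrC !subrK addrA [g + (f - h)]addrA [g + f]addrC.
Qed.

Let lerD2r (f g h : order_dual) : f <= g -> f + h <= g + h.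
Proof. by rewrite order_dual_leD2r. Qed.

Let lerZ2l (a : R) (f g : order_dual) : 0 <= a -> f <= g -> a *: f <= a *: g.
Proof.
move=> a0 /order_dual_leP fg; apply/order_dual_leP => x x0.
by rewrite !order_dualZ ler_wpM2l ?fg.
Qed.

HB.instance Definition _ := Lmodule_isVectorLattice.Build R order_dual
  joinP meetP lerD2r lerZ2l.

End order_dual.

Section adjoint.
Context (R : realType) (E F : vectorLatticeType R).
Variables (S : E -> F) (S_pos : positive_operator S).

Lemma order_adjoint_subproof (f : order_dual F) :
  (f \o S : E -> R^o) \in @order_dual_pred R E.
Proof.
have [lS S0] := S_pos.
rewrite inE; split=> [a x y|a b]; first by rewrite /= lS order_dual_linear.
have SB x y : x <= y -> S x <= S y.
  move=> xy; rewrite -vl_subr_ge0 (_ : S y - S x = S (y - x)).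
    by rewrite S0// vl_subr_ge0.
  by have := lS (-1) x y; rewrite !scaleN1r [y - x]addrC [S y - _]addrC => ->.
have [M fM] := order_dual_bounded f (S a) (S b).
by exists M => x /andP[ax xb]; apply: fM; rewrite !SB.
Qed.

Definition order_adjoint (f : order_dual F) : order_dual E :=
  OrderDual (order_adjoint_subproof f).

End adjoint.

(* The vector lattice of classes of measurable real functions modulo
   almost everywhere equality, with the almost everywhere order; a class
   coerces to one of its representatives. *)
Section L0.
Context (d : measure_display) (T : measurableType d) (R : realType).
Variable mu : {measure set T -> \bar R}.
Local Notation L0 := {mfun_ mu, T >-> measurableTypeR R}.
Implicit Types u v w : L0.

Lemma L0_measurable u : measurable_fun setT (u : T -> R).
Proof. by move=> mT Y mY; exact: (@measurable_funP _ _ _ _ setT (repr u) mT Y mY). Qed.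

Lemma measurableTypeRP (f : T -> R) : measurable_fun setT f ->
  (f : T -> measurableTypeR R) \in @mfun _ _ T (measurableTypeR R).
Proof. by move=> mf; apply/mem_set => mT Y mY; exact: mf. Qed.

Definition L0_class (f : T -> R) (mf : measurable_fun setT f) : L0 :=
  (\pi_(L0) (mfun_Sub (measurableTypeRP mf) : {mfun T >-> measurableTypeR R}))%qT.

Lemma L0_classE (f : T -> R) (mf : measurable_fun setT f) :
  \forall x \ae mu, (L0_class mf : T -> R) x = f x.
Proof.
rewrite /L0_class /aqEqMfun_to_fun; set g := mfun_Sub _.
have : (repr (\pi_(L0) g) = g %[mod L0])%qT by rewrite reprK.
move=> /eqP; rewrite eqmodE => /asboolP h.
by apply: filterS h => x /(_ Logic.I).
Qed.

Lemma L0P u v : (\forall x \ae mu, (u x : R) = v x) -> u = v.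
Proof.
move=> uv; rewrite -[u]reprK -[v]reprK; apply/eqP; rewrite eqmodE.
by apply/asboolP; apply: filterS uv.
Qed.

Definition L0_le u v := `[< \forall x \ae mu, (u x : R) <= v x >].

Let L0_le_refl : reflexive L0_le.
Proof. by move=> u; apply/asboolP/aeW. Qed.

Let L0_le_anti : antisymmetric L0_le.
Proof.
move=> u v /andP[/asboolP uv /asboolP vu]; apply: L0P.
by apply: filterS2 uv vu => x h1 h2; apply/le_anti; rewrite h1.
Qed.

Let L0_le_trans : transitive L0_le.
Proof.
move=> v u w /asboolP uv /asboolP vw; apply/asboolP.
by apply: filterS2 uv vw => x; exact: le_trans.
Qed.

Definition L0_zero : L0 := L0_class (@measurable_cst _ _ T _ setT (0 : R)).
Definition L0_add u v : L0 :=
  L0_class (measurable_funD (L0_measurable u) (L0_measurable v)).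
Definition L0_opp u : L0 := L0_class (measurable_funN (L0_measurable u)).
Definition L0_scale (a : R) u : L0 :=
  L0_class (measurable_funM (@measurable_cst _ _ T _ setT a) (L0_measurable u)).
Definition L0_join u v : L0 :=
  L0_class (measurable_maxr (L0_measurable u) (L0_measurable v)).
Definition L0_meet u v : L0 :=
  L0_class (measurable_minr (L0_measurable u) (L0_measurable v)).


Lemma L0_class_eq (f g : T -> R) (mf : measurable_fun setT f)
    (mg : measurable_fun setT g) :
  (\forall x \ae mu, f x = g x) -> L0_class mf = L0_class mg.
Proof.
move=> fg; apply: L0P.
by apply: filterS3 (L0_classE mf) (L0_classE mg) fg => x -> ->.
Qed.

Lemma L0_ind (P : L0 -> Prop) :
  (forall (f : T -> R) (mf : measurable_fun setT f), P (L0_class mf)) ->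
  forall u, P u.
Proof.
move=> Pf u; rewrite (_ : u = L0_class (L0_measurable u))//.
by apply: L0P; apply: filterS (L0_classE (L0_measurable u)) => x ->.
Qed.

Section class_operations.
Variables (f g : T -> R) (mf : measurable_fun setT f) (mg : measurable_fun setT g).

Lemma L0_add_class :
  L0_add (L0_class mf) (L0_class mg) = L0_class (measurable_funD mf mg).
Proof.
apply: L0_class_eq.
by apply: filterS2 (L0_classE mf) (L0_classE mg) => x /= -> ->.
Qed.

Lemma L0_opp_class :
  L0_opp (L0_class mf) = L0_class (measurable_funN mf).
Proof. by apply: L0_class_eq; apply: filterS (L0_classE mf) => x /= ->. Qed.

Lemma L0_scale_class a : L0_scale a (L0_class mf) =
  L0_class (measurable_funM (@measurable_cst _ _ T _ setT a) mf).
Proof. by apply: L0_class_eq; apply: filterS (L0_classE mf) => x /= ->. Qed.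

End class_operations.

Let addA : associative L0_add.
Proof.
elim/L0_ind=> f mf; elim/L0_ind=> g mg; elim/L0_ind=> h mh.
by rewrite !L0_add_class; apply/L0_class_eq/aeW => x /=; rewrite addrA.
Qed.

Let addC : commutative L0_add.
Proof.
elim/L0_ind=> f mf; elim/L0_ind=> g mg.
by rewrite !L0_add_class; apply/L0_class_eq/aeW => x /=; rewrite addrC.
Qed.

Let add0 : left_id L0_zero L0_add.
Proof.
elim/L0_ind=> f mf.
by rewrite !L0_add_class; apply/L0_class_eq/aeW => x /=; rewrite add0r.
Qed.

Let addN : left_inverse L0_zero L0_opp L0_add.
Proof.
elim/L0_ind=> f mf; rewrite L0_opp_class L0_add_class.
by apply/L0_class_eq/aeW => x /=; rewrite addNr.
Qed.

HB.instance Definition _ := GRing.isZmodule.Build L0 addA addC add0 addN.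

Let scaleA (a b : R) u : L0_scale a (L0_scale b u) = L0_scale (a * b) u.
Proof.
elim/L0_ind: u => f mf; rewrite !L0_scale_class.
by apply/L0_class_eq/aeW => x /=; rewrite mulrA.
Qed.

Let scale1 : left_id 1 L0_scale.
Proof.
elim/L0_ind=> f mf; rewrite L0_scale_class.
by apply/L0_class_eq/aeW => x /=; rewrite mul1r.
Qed.

Let scaleDr : right_distributive L0_scale +%R.
Proof.
move=> a; elim/L0_ind=> f mf; elim/L0_ind=> g mg.
rewrite [LHS](congr1 (L0_scale a) (L0_add_class mf mg)) !L0_scale_class.
rewrite [RHS]L0_add_class.
by apply/L0_class_eq/aeW => x /=; rewrite mulrDr.
Qed.

Let scaleDl u : {morph L0_scale^~ u : a b / a + b}.
Proof.
elim/L0_ind: u => f mf a b; rewrite !L0_scale_class [RHS]L0_add_class.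
by apply/L0_class_eq/aeW => x /=; rewrite mulrDl.
Qed.

HB.instance Definition _ := GRing.Zmodule_isLmodule.Build R L0
  scaleA scale1 scaleDr scaleDl.

HB.instance Definition _ := Order.Le_isPOrder.Build ring_display L0
  L0_le_refl L0_le_anti L0_le_trans.

Lemma L0_leP u v : reflect (\forall x \ae mu, (u x : R) <= v x) (u <= v).
Proof. exact: asboolP. Qed.

Lemma L0_zeroE : \forall x \ae mu, ((0 : L0) x : R) = 0.
Proof. exact: L0_classE. Qed.

Lemma L0_addE u v : \forall x \ae mu, ((u + v : L0) x : R) = u x + v x.
Proof. exact: L0_classE. Qed.

Lemma L0_scaleE (a : R) u : \forall x \ae mu, ((a *: u : L0) x : R) = a * u x.
Proof. exact: L0_classE. Qed.

Let joinP u v w : (L0_join u v <= w) = (u <= w) && (v <= w).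
Proof.
have h := L0_classE (measurable_maxr (L0_measurable u) (L0_measurable v)).
apply/L0_leP/andP => [uvw|[/L0_leP uw /L0_leP vw]].
  by split; apply/L0_leP; apply: filterS2 h uvw => x -> ;
    rewrite ge_max => /andP[].
by apply: filterS3 h uw vw => x -> ? ?; rewrite ge_max; apply/andP.
Qed.

Let meetP u v w : (w <= L0_meet u v) = (w <= u) && (w <= v).
Proof.
have h := L0_classE (measurable_minr (L0_measurable u) (L0_measurable v)).
apply/L0_leP/andP => [uvw|[/L0_leP uw /L0_leP vw]].
  by split; apply/L0_leP; apply: filterS2 h uvw => x -> ;
    rewrite le_min => /andP[].
by apply: filterS3 h uw vw => x -> ? ?; rewrite le_min; apply/andP.
Qed.

Let lerD2r u v w : u <= v -> u + w <= v + w.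
Proof.
move=> /L0_leP uv; apply/L0_leP.
by apply: filterS3 uv (L0_addE u w) (L0_addE v w) => x ? -> ->; rewrite lerD2r.
Qed.

Let lerZ2l (a : R) u v : 0 <= a -> u <= v -> a *: u <= a *: v.
Proof.
move=> a0 /L0_leP uv; apply/L0_leP.
apply: filterS3 uv (L0_scaleE a u) (L0_scaleE a v) => x ? -> ->.
exact: ler_wpM2l.
Qed.

HB.instance Definition _ := Lmodule_isVectorLattice.Build R L0
  joinP meetP lerD2r lerZ2l.

Lemma L0_joinE u v : \forall x \ae mu, ((vl_join u v : L0) x : R) = Num.max (u x : R) (v x : R).
Proof. exact: L0_classE. Qed.

End L0.

Section finite_norm.
Context (d : measure_display) (T : measurableType d) (R : realType).
Variable mu : {measure set T -> \bar R}.
Implicit Types (f g : T -> R) (p q : \bar R).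

Lemma finite_norm_realP (r : R) f : 1 <= r ->
  finite_norm mu r%:E f <-> (\int[mu]_x (`|f x| `^ r)%:E < +oo)%E.
Proof.
move=> r1; rewrite /finite_norm unlock.
rewrite (_ : (\int[mu]_x _ = \int[mu]_x (`|f x| `^ r)%:E)%E)//.
split; last exact: poweR_lty.
by apply: lty_poweRy; rewrite invr_eq0 gt_eqF// (lt_le_trans ltr01).
Qed.

Lemma finite_norm_ooP f : measurable_fun setT f ->
  finite_norm mu +oo%E f <-> exists M : R, \forall x \ae mu, `|f x| <= M.
Proof.
move=> mf; rewrite /finite_norm unlock; split.
- case: ifPn => [mu0 fy|]; last first.
    rewrite lt0e measure_ge0 andbT negbK => /eqP mu0 _.
    by exists 0; exists setT; split.
  have := ess_sup_ge mu (abse \o (EFin \o f)).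
  move: fy; case: (ess_sup _ _) => [r|//|] _ h.
    by exists r; apply: filterS h => x; rewrite /= lee_fin.
  exists 0; apply: filterS h => x /=; by rewrite leeNy_eq.
- move=> [M fM]; case: ifPn => // _; apply: (@le_lt_trans _ _ M%:E); last exact: ltry.
  by apply: ereal_inf_lbound => /=; apply: filterS fM => x; rewrite lee_fin.
Qed.

Lemma measurable_normr_powR (r : R) f : measurable_fun setT f ->
  measurable_fun setT (fun x => (`|f x| `^ r)%:E).
Proof.
move=> mf; apply/measurable_EFinP.
apply: (@measurableT_comp _ _ _ _ _ _ (@powR R ^~ r)) => //.
exact: measurableT_comp.
Qed.

Lemma finite_norm_le p f g : (1 <= p)%E ->
  measurable_fun setT f -> measurable_fun setT g ->
  (\forall x \ae mu, `|f x| <= `|g x|) -> finite_norm mu p g -> finite_norm mu p f.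
Proof.
case: p => [r r1|_|//] mf mg fg.
  rewrite lee_fin in r1; move=> /(finite_norm_realP _ r1) goo; apply/(finite_norm_realP _ r1).
  apply: le_lt_trans goo; apply: ae_ge0_le_integral => //.
  - exact: measurable_normr_powR.
  - exact: measurable_normr_powR.
  - apply: filterS fg => x fgx _; rewrite lee_fin ge0_ler_powR// ?nnegrE//.
    by rewrite (le_trans _ r1).
move=> /(finite_norm_ooP mg)[M gM]; apply/finite_norm_ooP => //.
by exists M; apply: filterS2 fg gM => x; exact: le_trans.
Qed.

Lemma finite_normD p f g : (1 <= p)%E ->
  measurable_fun setT f -> measurable_fun setT g ->
  finite_norm mu p f -> finite_norm mu p g -> finite_norm mu p (f \+ g).
Proof.
move=> p1 mf mg foo goo; apply: (le_lt_trans (eminkowski mu mf mg p1)).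
exact: lte_add_pinfty.
Qed.

Lemma finite_normZ p (a : R) f : (1 <= p)%E ->
  measurable_fun setT f -> finite_norm mu p f ->
  finite_norm mu p (fun x => a * f x).
Proof.
case: p => [r r1|_|//] mf.
  rewrite lee_fin in r1; have r0 : 0 <= r by exact: le_trans r1.
  move=> /(finite_norm_realP _ r1) foo; apply/(finite_norm_realP _ r1).
  under eq_integral do rewrite normrM powRM// EFinM.
  rewrite ge0_integralZl//.
  - by rewrite lte_mul_pinfty// lee_fin powR_ge0.
  exact: measurable_normr_powR.
move=> /(finite_norm_ooP mf)[M fM]; apply/finite_norm_ooP.
  exact: measurable_funM.
by exists (`|a| * M); apply: filterS fM => x fxM; rewrite normrM ler_wpM2l.
Qed.

Lemma finite_norm_linear p (a : R) f g : (1 <= p)%E ->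
  measurable_fun setT f -> measurable_fun setT g ->
  finite_norm mu p f -> finite_norm mu p g ->
  finite_norm mu p (fun x => a * f x + g x).
Proof.
move=> p1 mf mg foo goo.
exact: finite_normD (measurable_funM (measurable_cst a) mf) mg
  (finite_normZ a p1 mf foo) goo.
Qed.

Lemma finite_norm_max p f g : (1 <= p)%E ->
  measurable_fun setT f -> measurable_fun setT g ->
  finite_norm mu p f -> finite_norm mu p g ->
  finite_norm mu p (fun x => Num.max (f x) (g x)).
Proof.
move=> p1 mf mg foo goo.
have mnorm (h : T -> R) : measurable_fun setT h -> measurable_fun setT (fun x => `|h x : R|).
  by move=> mh; exact: measurableT_comp.
have norm_oo (h : T -> R) : measurable_fun setT h ->
    finite_norm mu p h -> finite_norm mu p (fun x => `|h x|).
  move=> mh hoo; apply: finite_norm_le hoo => //; first exact: mnorm.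
  by apply: aeW => x; rewrite normr_id.
apply: (@finite_norm_le _ _ ((fun x => `|f x|) \+ (fun x => `|g x|))) => //.
- exact: measurable_maxr.
- by apply: measurable_funD; exact: mnorm.
- apply: aeW => x /=; rewrite [leRHS]ger0_norm ?addr_ge0//.
  by rewrite maxEle; case: ifPn => _; [rewrite lerDr|rewrite lerDl].
- by apply: finite_normD => //; [exact: mnorm|exact: mnorm|exact: norm_oo|exact: norm_oo].
Qed.

Lemma finite_norm_ae p f g : (1 <= p)%E ->
  measurable_fun setT f -> measurable_fun setT g ->
  (\forall x \ae mu, f x = g x) -> finite_norm mu p g -> finite_norm mu p f.
Proof.
by move=> p1 mf mg fg; apply: finite_norm_le => //; apply: filterS fg => x ->.
Qed.

Lemma finite_norm_conjugate (p : R) q f g : (1 <= p%:E)%E -> (1 <= q)%E ->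
  (p%:E^-1 + q^-1 = 1)%E ->
  measurable_fun setT f -> measurable_fun setT g ->
  finite_norm mu q f -> finite_norm mu p%:E g ->
  (\int[mu]_x `|(f x * g x)%:E| < +oo)%E.
Proof.
rewrite lee_fin => p1 q1 pq mf mg foo goo.
have p0 : 0 < p by exact: lt_le_trans p1.
move: pq; rewrite inver gt_eqF//; case: q q1 foo => [q|_|//].
  rewrite lee_fin => q1 foo; have q0 : 0 < q by exact: lt_le_trans q1.
  rewrite inver gt_eqF// -EFinD => -[] pq.
  have := hoelder mu mf mg q0 p0; rewrite addrC pq => /(_ erefl).
  rewrite Lnorm1 => /le_lt_trans; apply.
  by rewrite lte_mul_pinfty ?Lnorm_ge0// ge0_fin_numE ?Lnorm_ge0.
rewrite invey adde0 => /(finite_norm_ooP mf)[M fM] [] /eqP.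
rewrite invr_eq1 => /eqP pE; subst p.
move: goo => /(finite_norm_realP _ p1).
under eq_integral do rewrite powRr1//.
move=> goo; apply: (@le_lt_trans _ _ (\int[mu]_x (`|M|%:E * `|g x|%:E))%E).
  apply: ae_ge0_le_integral => //.
  - apply: measurableT_comp => //; apply/measurable_EFinP.
    exact: measurable_funM.
  - apply: emeasurable_funM => //; apply/measurable_EFinP.
    exact: measurableT_comp.
  - apply: filterS fM => x fxM _; rewrite -EFinM lee_fin normrM ler_wpM2r//.
    by rewrite (le_trans fxM)// ler_norm.
rewrite ge0_integralZl//; first by rewrite lte_mul_pinfty.
by apply/measurable_EFinP; exact: measurableT_comp.
Qed.

End finite_norm.

Section restricted_measure.
Context (d : measure_display) (T : measurableType d) (R : realType).
Variables (mu : {measure set T -> \bar R}) (D : set T) (mD : measurable D).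
Local Notation muD := (mrestr mu mD).

Lemma ae_mrestr (P : T -> Prop) :
  (\forall x \ae muD, P x) <-> (\forall x \ae mu, D x -> P x).
Proof.
split=> -[N [mN N0 PN]].
  exists (N `&` D); split => //; first exact: measurableI.
  by move=> x /= /not_implyP[Dx nPx]; split => //; exact: PN.
exists (N `|` ~` D); split.
- by apply: measurableU => //; exact: measurableC.
- rewrite /= /mrestr setIUl setICl setU0.
  apply: (@subset_measure0 _ _ _ mu _ N) => //; exact: measurableI.
- move=> x /= nPx; have [Dx|] := pselect (D x); last by right.
  by left; apply: PN => /=; apply/not_implyP.
Qed.

Lemma ae_restr (P : T -> Prop) :
  (\forall x \ae mu, P x) -> (\forall x \ae muD, P x).
Proof. by move=> muP; apply/ae_mrestr; apply: filterS muP. Qed.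

Lemma ge0_integral_mrestr (f : T -> \bar R) :
  measurable_fun setT f -> (forall x, (0 <= f x)%E) ->
  (\int[muD]_x f x = \int[mu]_(x in D) f x)%E.
Proof.
move=> mf f0; have mCD := measurableC mD.
have mfD : measurable_fun D f by exact: measurable_funS mf.
transitivity (\int[muD]_(x in D) f x)%E.
  rewrite [LHS](ge0_negligible_integral mCD)//=; last first.
    by rewrite /mrestr setICl measure0.
  by rewrite setTD setCK.
apply: eq_measure_integral => A mA AD /=.
by rewrite /mrestr (setIidl AD).
Qed.

Lemma finite_norm_mrestr p (f : T -> R) : (1 <= p)%E -> measurable_fun setT f ->
  finite_norm (muD : {measure set T -> \bar R}) p f <->
  finite_norm mu p (fun x => f x * \1_D x).
Proof.
move=> p1 mf.
have mfD : measurable_fun setT (fun x => f x * \1_D x).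
  by apply: measurable_funM => //; exact: measurable_indic.
case: p p1 => [r|_|//].
  rewrite lee_fin => r1; apply: (iff_trans (finite_norm_realP muD f r1)).
  apply: iff_sym; apply: (iff_trans (finite_norm_realP mu _ r1)).
  suff -> : (\int[muD]_x (`|f x| `^ r)%:E =
             \int[mu]_x (`|f x * \1_D x| `^ r)%:E)%E by [].
  rewrite ge0_integral_mrestr//; last exact: measurable_normr_powR.
  rewrite integral_mkcond; apply: eq_integral => x _; rewrite patchE indicE.
  case: ifPn => _; first by rewrite mulr1.
  by rewrite mulr0 normr0 powR0// gt_eqF// (lt_le_trans ltr01).
apply: (iff_trans (finite_norm_ooP muD mf)); apply: iff_sym.
apply: (iff_trans (finite_norm_ooP mu mfD)); split=> -[M fM].
  exists M; apply/ae_mrestr; apply: filterS fM => x + Dx.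
  by rewrite indicE mem_set// mulr1.
exists `|M|; move/ae_mrestr : fM; apply: filterS => x fM; rewrite indicE.
have [/set_mem Dx|_] := boolP (x \in D); last by rewrite mulr0 normr0.
by rewrite mulr1 (le_trans (fM Dx))// ler_norm.
Qed.

End restricted_measure.

Section Lspace_vector_lattice.
Context (d : measure_display) (T : measurableType d) (R : realType).
Variable mu : {measure set T -> \bar R}.
Local Notation L0 := {mfun_ mu, T >-> measurableTypeR R}.

Section finite_norm_closed.
Variables (p : \bar R) (p1 : (1 <= p)%E).

Lemma finite_norm_L0_0 : finite_norm mu p (0 : L0).
Proof.
apply: (@finite_norm_ae _ _ _ _ _ _ (cst 0)) => //; first exact: L0_measurable.
  exact: L0_zeroE.
by rewrite /finite_norm Lnorm0// gt_eqF// (lt_le_trans _ p1).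
Qed.

Definition Lspace_pred : pred L0 := fun u => finite_norm mu p u.

Lemma Lspace_pred_submod : submod_closed Lspace_pred.
Proof.
split; first exact: finite_norm_L0_0.
move=> a u v uoo voo; have mu_ := L0_measurable u; have mv := L0_measurable v.
change (finite_norm mu p (a *: u + v : L0)).
apply: (@finite_norm_ae _ _ _ _ _ _ (fun x => a * ((u : L0) x : R) + ((v : L0) x : R))) => //.
- exact: L0_measurable.
- exact: measurable_funD (measurable_funM (measurable_cst a) mu_) mv.
- by apply: filterS2 (L0_addE (a *: u) v) (L0_scaleE a u) => x -> ->.
- exact: finite_norm_linear.
Qed.

Lemma Lspace_pred_join (u v : L0) :
  u \in Lspace_pred -> v \in Lspace_pred -> vl_join u v \in Lspace_pred.
Proof.
move=> uoo voo; have mu_ := L0_measurable u; have mv := L0_measurable v.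
change (finite_norm mu p (vl_join u v : L0)).
apply: (@finite_norm_ae _ _ _ _ _ _ (fun x => Num.max (u x : R) (v x : R))) => //.
- exact: L0_measurable.
- exact: measurable_maxr.
- exact: L0_joinE.
- exact: finite_norm_max.
Qed.

Section Sub.
Context (u : L0) (uP : Lspace_pred u).
Definition Lspace_Sub_subproof := @isFinLebesgue.Build d T R mu p p1 u uP.
#[local] HB.instance Definition _ := Lspace_Sub_subproof.
Definition Lspace_Sub : LspaceType mu p1 := [the LspaceType mu p1 of u].
End Sub.

Lemma Lspace_rect (K : LspaceType mu p1 -> Type) :
  (forall u (uP : Lspace_pred u), K (Lspace_Sub uP)) -> forall u, K u.
Proof. by move=> Ksub [u [[uP]]]; exact: Ksub. Qed.

Lemma Lspace_valP u (uP : Lspace_pred u) : Lspace_Sub uP = u :> L0.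
Proof. by []. Qed.

HB.instance Definition _ := isSub.Build _ _ (LspaceType mu p1) Lspace_rect Lspace_valP.
HB.instance Definition _ := [Choice of LspaceType mu p1 by <:].
HB.instance Definition _ := @SubChoice_isSubVectorLattice.Build R L0 Lspace_pred
  (LspaceType mu p1) Lspace_pred_submod Lspace_pred_join.

End finite_norm_closed.
End Lspace_vector_lattice.


Section Lspace_class.
Context (d : measure_display) (T : measurableType d) (R : realType).
Variables (mu : {measure set T -> \bar R}) (p : \bar R) (p1 : (1 <= p)%E).
Implicit Types u v : LspaceType mu p1.
Local Notation L0 := {mfun_ mu, T >-> measurableTypeR R}.

Lemma finite_norm_class (f : T -> R) (mf : measurable_fun setT f) :
  finite_norm mu p f -> finite_norm mu p (L0_class mu mf).
Proof.
apply: finite_norm_ae => //; first exact: L0_measurable.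
exact: L0_classE.
Qed.

Definition Lspace_class (f : T -> R) (mf : measurable_fun setT f)
  (foo : finite_norm mu p f) : LspaceType mu p1 :=
  Lspace_Sub p1 (finite_norm_class mf foo).

Lemma Lspace_classE (f : T -> R) (mf : measurable_fun setT f)
    (foo : finite_norm mu p f) :
  \forall x \ae mu, (Lspace_class mf foo x : R) = f x.
Proof. exact: L0_classE. Qed.

Lemma Lspace_measurable u : measurable_fun setT (u : T -> R).
Proof. exact: L0_measurable. Qed.

Lemma LspaceP u v : (\forall x \ae mu, (u x : R) = v x) -> u = v.
Proof. by move=> uv; apply/val_inj/L0P. Qed.

Lemma Lspace_leP u v : reflect (\forall x \ae mu, (u x : R) <= v x) (u <= v).
Proof. exact: L0_leP. Qed.

Lemma Lspace_zeroE : \forall x \ae mu, ((0 : LspaceType mu p1) x : R) = 0.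
Proof. exact: L0_zeroE. Qed.

Lemma Lspace_linearE (a : R) u v :
  \forall x \ae mu, ((a *: u + v : LspaceType mu p1) x : R) = a * u x + v x.
Proof.
have := L0_addE (a *: (u : L0)) (v : L0).
by apply: filterS2 (L0_scaleE a (u : L0)) => x -> ->.
Qed.

Lemma Lspace_joinE u v : \forall x \ae mu,
  ((vl_join u v : LspaceType mu p1) x : R) = Num.max (u x : R) (v x : R).
Proof. exact: L0_joinE. Qed.

End Lspace_class.

(* For measurable D, the space L^p(D) is LspaceType (mrestr mu mD) p1: functions
   on the whole of T, identified when they agree almost everywhere on D (every
   measurable function on D extends to T), with the L^p-norm of mu restricted
   to D. *)

Section Lspace_duality.
Context (d : measure_display) (T : measurableType d) (R : realType).
Variables (mu : {measure set T -> \bar R}) (D : set T) (mD : measurable D).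
Variables (p : R) (q : \bar R) (p1 : (1 <= p%:E)%E) (q1 : (1 <= q)%E).
Hypothesis pq : (p%:E^-1 + q^-1 = 1)%E.
Local Notation Lp := (LspaceType (mrestr mu mD) p1).
Local Notation Lq := (LspaceType (mrestr mu mD) q1).

Definition Lspace_pairing (u : Lq) (v : Lp) : R^o :=
  \int[mu]_(x in D) ((u x : R) * (v x : R)).

Lemma Lspace_pairing_integrable (u : Lq) (v : Lp) :
  mu.-integrable D (EFin \o (fun x => (u x : R) * (v x : R))).
Proof.
have mu_ := Lspace_measurable u; have mv := Lspace_measurable v.
have muv : measurable_fun setT (EFin \o (fun x => (u x : R) * (v x : R))).
  by apply/measurable_EFinP; exact: measurable_funM.
apply/integrableP; split; first exact: measurable_funS muv.
rewrite -ge0_integral_mrestr//; last exact: measurableT_comp.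
exact: finite_norm_conjugate p1 q1 pq mu_ mv Lebesgue_finite Lebesgue_finite.
Qed.

Lemma Lspace_pairing_linear u : linear (Lspace_pairing u).
Proof.
move=> a v w; rewrite /Lspace_pairing.
change (\int[mu]_(x in D) ((u x : R) * ((a *: v + w : Lp) x : R)) =
  a * (\int[mu]_(x in D) ((u x : R) * (v x : R))) +
  \int[mu]_(x in D) ((u x : R) * (w x : R))).
rewrite -RintegralZl//; last exact: Lspace_pairing_integrable.
rewrite -RintegralD//; last 2 first.
- have := integrableZl mD a (Lspace_pairing_integrable u v).
  by apply: eq_integrable => // x _; rewrite /= EFinM.
- exact: Lspace_pairing_integrable.
rewrite /Rintegral; congr fine; apply: ae_eq_integral => //.
- exact: measurable_int (Lspace_pairing_integrable _ _).
- apply/measurable_EFinP; apply: measurable_funD.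
    apply: measurable_funM => //.
    by apply/measurable_EFinP; exact: measurable_int (Lspace_pairing_integrable u v).
  by apply/measurable_EFinP; exact: measurable_int (Lspace_pairing_integrable u w).
- have /ae_mrestr := Lspace_linearE a v w.
  apply: filterS => x vw Dx; congr EFin; rewrite vw//; ring.
Qed.

Lemma Lspace_pairing_bounded u : order_bounded (Lspace_pairing u).
Proof.
move=> a b.
pose g x := `|(u x : R) * (a x : R)| + `|(u x : R) * (b x : R)|.
have int_norm v : mu.-integrable D (EFin \o (fun x => `|(u x : R) * (v : Lp) x : R|)).
  exact: integrable_abse (Lspace_pairing_integrable u v).
have g_int : mu.-integrable D (EFin \o g).
  by have := integrableD mD (int_norm a) (int_norm b); exact: eq_integrable.
exists (\int[mu]_(x in D) g x) => v /andP[/Lspace_leP av /Lspace_leP vb].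
apply: le_trans (le_normr_Rintegral mD (Lspace_pairing_integrable u v)) _.
apply: fine_le.
- exact: integrable_fin_num (int_norm v).
- exact: integrable_fin_num g_int.
move/ae_mrestr : av => av; move/ae_mrestr : vb => vb.
apply: ae_ge0_le_integral => //.
- exact: measurable_int (int_norm v).
- by move=> x _; rewrite lee_fin addr_ge0.
- exact: measurable_int g_int.
apply: filterS2 av vb => x av vb Dx; rewrite lee_fin /g !normrM -mulrDr.
rewrite ler_wpM2l//; have {}av := av Dx; have {}vb := vb Dx.
rewrite ler_norml; apply/andP; split.
  by rewrite (le_trans _ av)// lerNl (le_trans _ (_ : `|a x : R| <= _)) ?lerDl// -normrN ler_norm.
by rewrite (le_trans vb)// (le_trans (ler_norm _))// lerDr.
Qed.

Lemma Lspace_pairing_subproof u :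
  Lspace_pairing u \in @order_dual_pred R Lp.
Proof.
by rewrite inE; split; [exact: Lspace_pairing_linear|exact: Lspace_pairing_bounded].
Qed.

Definition Lspace_duality (u : Lq) : order_dual Lp :=
  OrderDual (Lspace_pairing_subproof u).

End Lspace_duality.
Arguments Lspace_duality {d T R} mu {D} mD {p q} p1 q1 pq u.

Section Xi_spaces.
Context (d : measure_display) (T : measurableType d) (R : realType).
Variables (mu : {measure set T -> \bar R}) (X : (set T)^nat).
Local Notation L0 := {mfun_ mu, T >-> measurableTypeR R}.

Section compact_support.
Variables (q : \bar R) (q1 : (1 <= q)%E).

Definition Lspace_c_pred : pred (LspaceType mu q1) := fun u =>
  `[< exists n, \forall x \ae mu, ~ X n x -> (u x : R) = 0 >].

(* ndX does not occur in the fields but the vector lattice structure needs it *)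
Record Lspace_c (ndX : {homo X : m n / (m <= n)%N >-> m `<=` n}) := LspaceC {
  Lspace_c_val :> LspaceType mu q1 ;
  Lspace_c_valP : Lspace_c_pred Lspace_c_val }.

Variable ndX : {homo X : m n / (m <= n)%N >-> m `<=` n}.
Local Notation Lc := (Lspace_c ndX).

HB.instance Definition _ := [isSub for @Lspace_c_val ndX].
HB.instance Definition _ := [Choice of Lc by <:].

Let supp_le (u : LspaceType mu q1) m n : (m <= n)%N ->
  (\forall x \ae mu, ~ X m x -> (u x : R) = 0) ->
  \forall x \ae mu, ~ X n x -> (u x : R) = 0.
Proof.
move=> mn; apply: filterS => x + nXx; apply.
by apply: contra_not nXx; exact: ndX.
Qed.

Let supp2 (u v : LspaceType mu q1) :
  u \in Lspace_c_pred -> v \in Lspace_c_pred ->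
  exists n, \forall x \ae mu, ~ X n x -> (u x : R) = 0 /\ (v x : R) = 0.
Proof.
move=> /asboolP[m um] /asboolP[n vn]; exists (maxn m n).
have um' := supp_le (leq_maxl m n) um; have vn' := supp_le (leq_maxr m n) vn.
by apply: filterS2 um' vn' => x ux vx nX; rewrite ux ?vx.
Qed.

Lemma Lspace_c_submod : submod_closed Lspace_c_pred.
Proof.
split.
  by apply/asboolP; exists 0%N; apply: filterS (@Lspace_zeroE _ _ _ mu _ q1).
move=> a u v uP vP; have [n uv] := supp2 uP vP; apply/asboolP; exists n.
apply: filterS2 (Lspace_linearE a u v) uv => x -> uv /uv[-> ->].
by rewrite mulr0 addr0.
Qed.

Lemma Lspace_c_join (u v : LspaceType mu q1) :
  u \in Lspace_c_pred -> v \in Lspace_c_pred -> vl_join u v \in Lspace_c_pred.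
Proof.
move=> uP vP; have [n uv] := supp2 uP vP; apply/asboolP; exists n.
by apply: filterS2 (Lspace_joinE u v) uv => x -> uv /uv[-> ->]; rewrite maxxx.
Qed.

HB.instance Definition _ := @SubChoice_isSubVectorLattice.Build R (LspaceType mu q1)
  Lspace_c_pred Lc Lspace_c_submod Lspace_c_join.

End compact_support.

Section local.
Variables (mX : forall n, measurable (X n)) (p : \bar R) (p1 : (1 <= p)%E).

Definition Lspace_loc_pred : pred L0 := fun u =>
  `[< forall n, finite_norm (mrestr mu (mX n)) p (fun x => (u x : R) * \1_(X n) x) >].

(* p1 does not occur in the fields but the vector lattice structure needs it *)
Record Lspace_loc (p1 : (1 <= p)%E) := LspaceLoc {
  Lspace_loc_val :> L0 ;
  Lspace_loc_valP : Lspace_loc_pred Lspace_loc_val }.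

Local Notation Lloc := (Lspace_loc p1).

HB.instance Definition _ := [isSub for @Lspace_loc_val p1].
HB.instance Definition _ := [Choice of Lloc by <:].

Lemma Lspace_loc_predP (u : L0) : u \in Lspace_loc_pred <->
  forall n, finite_norm (mrestr mu (mX n)) p u.
Proof.
have mu1 n : measurable_fun setT (fun x => (u x : R) * \1_(X n) x).
  by apply: measurable_funM (L0_measurable u) _; exact: measurable_indic.
have e n : \forall x \ae mrestr mu (mX n), (u x : R) * \1_(X n) x = u x.
  by apply/ae_mrestr/aeW => x Xx; rewrite indicE mem_set// mulr1.
split=> [/asboolP uP n|uP]; last apply/asboolP => n.
  apply: finite_norm_ae (uP n) => //; first exact: L0_measurable.
  by apply: filterS (e n) => x ->.
by apply: finite_norm_ae (uP n) => //; [exact: L0_measurable|exact: e].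
Qed.

Lemma Lspace_loc_submod : submod_closed Lspace_loc_pred.
Proof.
split.
  apply/Lspace_loc_predP => n; apply: (@finite_norm_ae _ _ _ _ _ _ (cst 0)) => //.
  - exact: L0_measurable.
  - exact/ae_restr/L0_zeroE.
  - by rewrite /finite_norm Lnorm0// gt_eqF// (lt_le_trans _ p1).
move=> a u v /Lspace_loc_predP uP /Lspace_loc_predP vP; apply/Lspace_loc_predP => n.
have mu_ := L0_measurable u; have mv := L0_measurable v.
apply: (@finite_norm_ae _ _ _ _ _ _ (fun x => a * ((u : L0) x : R) + ((v : L0) x : R))) => //.
- exact: L0_measurable.
- exact: measurable_funD (measurable_funM (measurable_cst a) mu_) mv.
- by apply: ae_restr; apply: filterS2 (L0_addE (a *: u) v) (L0_scaleE a u) => x -> ->.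
- exact: finite_norm_linear.
Qed.

Lemma Lspace_loc_join (u v : L0) :
  u \in Lspace_loc_pred -> v \in Lspace_loc_pred -> vl_join u v \in Lspace_loc_pred.
Proof.
move=> /Lspace_loc_predP uP /Lspace_loc_predP vP; apply/Lspace_loc_predP => n.
have mu_ := L0_measurable u; have mv := L0_measurable v.
apply: (@finite_norm_ae _ _ _ _ _ _ (fun x => Num.max (u x : R) (v x : R))) => //.
- exact: L0_measurable.
- exact: measurable_maxr.
- exact/ae_restr/L0_joinE.
- exact: finite_norm_max.
Qed.

HB.instance Definition _ := @SubChoice_isSubVectorLattice.Build R L0
  Lspace_loc_pred Lloc Lspace_loc_submod Lspace_loc_join.

End local.
End Xi_spaces.
Arguments Lspace_c {d T R} mu {X q} q1 ndX.
Arguments Lspace_loc {d T R} mu {X} mX {p} p1.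

Section extension_restriction.
Context (d : measure_display) (T : measurableType d) (R : realType).
Variables (mu : {measure set T -> \bar R}) (X : (set T)^nat).
Variables (mX : forall n, measurable (X n)).

Section extension.
Variables (ndX : {homo X : m n / (m <= n)%N >-> m `<=` n}) (q : \bar R) (q1 : (1 <= q)%E) (n : nat).
Variable u : LspaceType (mrestr mu (mX n)) q1.

Let f x : R := (u x : R) * \1_(X n) x.

Let mf : measurable_fun setT f.
Proof.
by apply: measurable_funM (Lspace_measurable u) _; exact: measurable_indic.
Qed.

Let f_fin : finite_norm mu q f.
Proof.
apply/finite_norm_mrestr => //; [exact: Lspace_measurable|exact: Lebesgue_finite].
Qed.

Lemma extension0_subproof : Lspace_c_pred X (Lspace_class q1 mf f_fin).
Proof.
apply/asboolP; exists n; apply: filterS (Lspace_classE q1 mf f_fin) => x ->.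
by move=> nXx; rewrite /f indicE memNset// mulr0.
Qed.

Definition extension0 : Lspace_c mu q1 ndX := LspaceC ndX extension0_subproof.

End extension.

Section restriction_map.
Variables (p : \bar R) (p1 : (1 <= p)%E) (n : nat).

Let u_fin (u : Lspace_loc mu mX p1) : finite_norm (mrestr mu (mX n)) p u.
Proof. by have /Lspace_loc_predP := Lspace_loc_valP u; exact. Qed.

Definition restriction (u : Lspace_loc mu mX p1) : LspaceType (mrestr mu (mX n)) p1 :=
  Lspace_class p1 (L0_measurable u) (u_fin u).

Lemma restrictionE (u : Lspace_loc mu mX p1) :
  \forall x \ae mrestr mu (mX n), (restriction u x : R) = u x.
Proof. exact: Lspace_classE. Qed.

Lemma restriction_positive : positive_operator restriction.
Proof.
split=> [a u v|u u0].
  apply: LspaceP.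
  have uv : \forall x \ae mrestr mu (mX n),
      ((a *: u + v : Lspace_loc mu mX p1) x : R) = a * u x + v x.
    apply: ae_restr.
    have := L0_addE (a *: Lspace_loc_val u) (Lspace_loc_val v).
    by apply: filterS2 (L0_scaleE a (Lspace_loc_val u)) => x -> ->.
  have uvE : \forall x \ae mrestr mu (mX n),
      (restriction (a *: u + v) x : R) = a * u x + v x.
    by apply: filterS2 (restrictionE (a *: u + v)) uv => x -> ->.
  have uvR : \forall x \ae mrestr mu (mX n),
      a * (restriction u x : R) + (restriction v x : R) = a * u x + v x.
    by apply: filterS2 (restrictionE u) (restrictionE v) => x -> ->.
  apply: filterS3 uvE uvR (Lspace_linearE a (restriction u) (restriction v)).
  by move=> x -> <- ->.
apply/Lspace_leP.
have /L0_leP u0' : 0 <= Lspace_loc_val u by exact: u0.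
have u0r := ae_restr (mX n) u0'.
have zr := ae_restr (mX n) (L0_zeroE mu).
have u0z : \forall x \ae mrestr mu (mX n), 0 <= (u x : R).
  by apply: filterS2 u0r zr => x + z0; rewrite z0.
apply: filterS3 u0z (restrictionE u) (Lspace_zeroE (mrestr mu (mX n)) p1).
by move=> x ? -> ->.
Qed.

End restriction_map.

End extension_restriction.
Arguments extension0 {d T R} mu {X} mX ndX {q} q1 n u.
Arguments restriction {d T R} mu {X} mX {p} p1 n u.
Arguments restriction_positive {d T R} mu {X} mX {p} p1 n.

(* Main.v *)
From HB Require Import structures.
Require Import Defs.
From mathcomp Require Import all_boot all_order all_algebra.
From mathcomp Require Import all_classical all_reals all_analysis.
From mathcomp Require Import measurable_realfun ring.
Import Order.TTheory GRing.Theory Num.Theory.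
Import numFieldNormedType.Exports.
Local Open Scope classical_set_scope.
Local Open Scope ring_scope.
Set Implicit Arguments.
Unset Strict Implicit.
Unset Printing Implicit Defensive.

(* R is the pairing R u v = \int_X u v. The point is surjectivity, and it
   suffices to represent a positive functional Phi on L^p_loc.
   - If v_n >= 0 and \int_{X_n} v_n ^ p <= 2 ^ -n, then (\sum_n v_n ^ p) ^ (1/p)
     lies in L^p_loc and dominates every v_n, so Phi (v_n) is bounded. Hence for
     some n and C, Phi f ^ p <= C * \int_{X_n} f ^ p for all f >= 0: one argument
     gives both the localisation of Phi on X_n and its norm continuity.
   - Fix W > 0 a.e. in L^p_loc. Then A |-> Phi (W 1_A) is a finite measure
     absolutely continuous with respect to mu; dividing its Radon-Nikodym
     derivative by W gives the density g of Phi.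
   - The bound above, tested on min (g ^ (q - 1), k W) if q < +oo and on
     W 1_{g > C} if q = +oo, shows that g is in L^q.
   Testing u on W 1_{u < 0} shows that R u >= 0 forces u >= 0, so R is
   injective and bipositive, hence a lattice isomorphism. *)

(** * Locally p-integrable functions *)

Section locally_power_integrable.
Context (d : measure_display) (T : measurableType d) (R : realType).
Variables (mu : {measure set T -> \bar R}) (X : (set T)^nat).
Hypothesis mX : forall n, measurable (X n).
Hypothesis X_cover : \bigcup_n X n = [set: T].
Variable p : R.
Hypothesis p1 : 1 <= p.
Implicit Types f g : T -> R.

Definition powint (D : set T) f := (\int[mu]_(x in D) (f x `^ p)%:E)%E.

(* The positive cone of L^p_loc, at the level of functions. *)
Definition locp f := [/\ measurable_fun setT f, forall x, 0 <= f x &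
  forall k, (powint (X k) f < +oo)%E].

Let p0 : 0 < p. Proof. exact: lt_le_trans ltr01 p1. Qed.

Lemma measurable_powint (D : set T) (r : R) f : measurable_fun setT f ->
  measurable_fun D (fun x => (f x `^ r)%:E).
Proof.
move=> mf; apply: measurable_funTS; apply/measurable_EFinP.
exact: (@measurableT_comp _ _ _ _ _ _ (@powR R ^~ r)).
Qed.

Lemma powint_ge0 (D : set T) f : (0 <= powint D f)%E.
Proof. by apply: integral_ge0 => x _; rewrite lee_fin powR_ge0. Qed.

Lemma powint_le (D : set T) f g : measurable D ->
  measurable_fun setT f -> measurable_fun setT g -> (forall x, 0 <= f x) ->
  (forall x, f x <= g x) -> (powint D f <= powint D g)%E.
Proof.
move=> mD mf mg f0 fg; apply: ge0_le_integral => //.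
- by move=> x _; rewrite lee_fin powR_ge0.
- exact: measurable_powint.
- exact: measurable_powint.
- move=> x _; rewrite lee_fin; apply: ge0_ler_powR; rewrite ?nnegrE ?(ltW p0)//.
  exact: le_trans (fg x).
Qed.

Lemma powintZ (D : set T) (a : R) f : measurable D -> 0 <= a ->
  measurable_fun setT f -> (forall x, 0 <= f x) ->
  powint D (fun x => a * f x) = ((a `^ p)%:E * powint D f)%E.
Proof.
move=> mD a0 mf f0; rewrite /powint -ge0_integralZl ?lee_fin ?powR_ge0//.
- by apply: eq_integral => x _; rewrite powRM.
- exact: measurable_powint.
- by move=> x _; rewrite lee_fin powR_ge0.
Qed.

Lemma locp_le f g : measurable_fun setT f -> (forall x, 0 <= f x) ->
  (forall x, f x <= g x) -> locp g -> locp f.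
Proof.
move=> mf f0 fg [mg g0 goo]; split; [exact: mf|exact: f0|move=> k].
by apply: le_lt_trans (goo k); exact: powint_le.
Qed.

Lemma locpZ (a : R) f : 0 <= a -> locp f -> locp (fun x => a * f x).
Proof.
move=> a0 [mf f0 foo]; split=> [|x|k]; [exact: measurable_funM|exact: mulr_ge0|].
by rewrite powintZ// lte_mul_pinfty// lee_fin powR_ge0.
Qed.

(** Summing p-th powers lets series and integral be exchanged, so \int_{X k} V ^ p is at most the
    sum of the \int_{X k} v_n ^ p. As that sum is finite, the series itself is finite a.e. on each
    [X k], hence a.e. *)
Lemma exists_locp_bound (v : (T -> R)^nat) :
  (forall n, measurable_fun setT (v n)) -> (forall n x, 0 <= v n x) ->
  (forall k, (\sum_(n <oo) powint (X k) (v n) < +oo)%E) ->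
  exists2 V, locp V & forall n, \forall x \ae mu, v n x <= V x.
Proof.
move=> mv v0 voo.
pose S x := (\sum_(n <oo) (v n x `^ p)%:E)%E.
have S0 x : (0 <= S x)%E by apply: nneseries_ge0 => n _; rewrite lee_fin powR_ge0.
have mS : measurable_fun setT S.
  apply: ge0_emeasurable_sum => [n x _ _|n _]; first by rewrite lee_fin powR_ge0.
  exact: measurable_powint.
have Soo k : (\int[mu]_(x in X k) S x < +oo)%E.
  rewrite integral_nneseries ?voo// => n.
    exact: measurable_powint.
  by move=> x _; rewrite lee_fin powR_ge0.
have Sfin : \forall x \ae mu, S x \is a fin_num.
  have : \forall x \ae mu, forall k, X k x -> S x \is a fin_num.
    apply/ae_foralln => k; apply: (integrable_ae (mX k)); apply/integrableP; split.
      exact: measurable_funTS.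
    by under eq_integral do rewrite gee0_abs//.
  apply: filterS => x Sx; have [k _ Xk] : (\bigcup_n X n) x by rewrite X_cover.
  exact: Sx Xk.
(* Where the series diverges [fine] gives 0, so V ^ p <= S holds everywhere, but v_n <= V only
   a.e. *)
pose V x := fine (S x) `^ p^-1.
have mV : measurable_fun setT V.
  apply: (@measurableT_comp _ _ _ _ _ _ (@powR R ^~ p^-1)) => //.
  exact: measurableT_comp.
have V0 x : 0 <= V x by exact: powR_ge0.
have VE x : V x `^ p = fine (S x).
  by rewrite /V -powRrM mulVf ?gt_eqF// powRr1// fine_ge0.
exists V.
  split=> // k.
  apply: le_lt_trans (Soo k); apply: ge0_le_integral => //.
  - by move=> x _; rewrite lee_fin powR_ge0.
  - exact: measurable_powint.
  - exact: measurable_funTS.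
  - move=> x _; rewrite VE; have := S0 x; case: (S x) => //= _; exact: leey.
move=> n; apply: filterS Sfin => x Sx.
have : v n x `^ p <= V x `^ p.
  rewrite VE -lee_fin fineK// /S.
  rewrite (nneseriesD1 (n := n))//=; last by move=> k _; rewrite lee_fin powR_ge0.
  by rewrite leeDl// nneseries_ge0// => *; rewrite lee_fin powR_ge0.
have [//|Vv] := leP (v n x) (V x).
by rewrite leNgt gt0_ltr_powR ?nnegrE// V0.
Qed.

Lemma powint_indic (D A : set T) (c : R) : measurable D -> measurable A -> 0 <= c ->
  powint D (fun x => c * \1_A x) = ((c `^ p)%:E * mu (A `&` D))%E.
Proof.
move=> mD mA c0; have mf : measurable_fun setT (\1_A : T -> R) by exact: measurable_indic.
rewrite powintZ// -integral_indic// /powint; congr (_ * _)%E.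
apply: eq_integral => x _; rewrite indicE.
by case: (x \in A); rewrite ?powR1// powR0// gt_eqF.
Qed.

(** The [X n] may have infinite measure, so the weight is built from a countable cover by sets of
    finite measure: it dominates small multiples of all their indicators. *)
Lemma exists_locp_gt0 : sigma_finite [set: T] mu ->
  exists2 W, locp W & \forall x \ae mu, 0 < W x.
Proof.
move=> [F UF Foo].
(* Chosen so that e_n mu(F_n) <= 2 ^ -(n+1); adding 1 keeps the denominator positive when F_n is
   null. The multiple c_n is the p-th root of e_n. *)
pose e n : R := (1 / (2 ^ n.+1)%:R) / (1 + fine (mu (F n))).
have d0 n : 0 < 1 + fine (mu (F n)) by rewrite ltr_wpDr ?fine_ge0.
have e0 n : 0 < e n by rewrite !divr_gt0// ltr0n expn_gt0.
pose c n := e n `^ p^-1.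
have c0 n : 0 < c n by exact: powR_gt0.
have cE n : c n `^ p = e n by rewrite /c -powRrM mulVf ?gt_eqF// powRr1// ltW.
have mF n : measurable (F n) := (Foo n).1.
have [|n x|k|W Wloc FW] := @exists_locp_bound (fun n x => c n * \1_(F n) x).
- by move=> n; apply: measurable_funM => //; exact: measurable_indic.
- by rewrite mulr_ge0// ltW.
- apply: (@le_lt_trans _ _ 1%:E); last exact: ltry.
  apply: le_trans (epsilon_trick0 xpredT ler01); apply: lee_nneseries => [n _ _|n _].
    exact: powint_ge0.
  rewrite powint_indic// ?(ltW (c0 n))// cE.
  apply: (@le_trans _ _ ((e n)%:E * mu (F n))%E).
    by rewrite lee_wpmul2l ?lee_fin ?(ltW (e0 n))// le_measure ?inE//; exact: measurableI.
  have : mu (F n) \is a fin_num by rewrite ge0_fin_numE// (Foo n).2.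
  move=> /fineK <-; rewrite -EFinM lee_fin /e mulrAC ler_pdivrMr//.
  by rewrite ler_wpM2l// lerDr.
exists W => //; have : \forall x \ae mu, forall n, c n * \1_(F n) x <= W x.
  exact/ae_foralln.
apply: filterS => x Wx; have [n _ Fx] : (\bigcup_n F n) x by rewrite -UF.
by apply: lt_le_trans (Wx n); rewrite indicE mem_set// mulr1.
Qed.

End locally_power_integrable.

(** * Positive functionals on nonnegative functions *)

Lemma cvgn_powR0 (R : realType) (r : R) (a : R^nat) : 0 < r ->
  (forall k, 0 <= a k) -> a @ \oo --> (0 : R) ->
  (fun k => a k `^ r) @ \oo --> (0 : R).
Proof.
move=> r0 a0 /cvgr0Pnorm_lt acvg; apply/cvgr0Pnorm_lt => e e0.
have := acvg (e `^ r^-1) (powR_gt0 _ e0); apply: filterS => k.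
rewrite !ger0_norm ?powR_ge0// => ake.
rewrite -[e](powRr1 (ltW e0)) -(mulVf (lt0r_neq0 r0)) powRrM.
by apply: gt0_ltr_powR; rewrite ?nnegrE ?powR_ge0.
Qed.

Section positive_functional.
Context (d : measure_display) (T : measurableType d) (R : realType).
Variables (mu : {measure set T -> \bar R}) (X : (set T)^nat).
Hypothesis mX : forall n, measurable (X n).
Hypothesis ndX : {homo X : m n / (m <= n)%N >-> m `<=` n}.
Hypothesis X_cover : \bigcup_n X n = [set: T].
Variable p : R.
Hypothesis p1 : 1 <= p.
(** Phi is a total map on functions, constrained only on [locp]. Since [Phi_le] compares almost
    everywhere, Phi ignores null sets there. *)
Variable Phi : (T -> R) -> R.
Local Notation locp := (locp mu X p).
Hypothesis PhiD : forall f g, locp f -> locp g -> Phi (f \+ g) = Phi f + Phi g.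
Hypothesis PhiZ : forall (a : R) f, 0 <= a -> locp f -> Phi (fun x => a * f x) = a * Phi f.
Hypothesis Phi_le : forall f g, locp f -> locp g ->
  (\forall x \ae mu, f x <= g x) -> Phi f <= Phi g.

Let p0 : 0 < p. Proof. exact: lt_le_trans ltr01 p1. Qed.

Lemma locp0 : locp (cst 0).
Proof.
split=> // k; rewrite /powint; under eq_integral do rewrite powR0 ?gt_eqF//.
by rewrite integral0.
Qed.

Lemma Phi0 : Phi (cst 0) = 0.
Proof.
rewrite -[RHS](mul0r (Phi (cst 0))) -PhiZ; [|by []|exact: locp0].
by congr Phi; apply/funext => x; rewrite mul0r.
Qed.

Lemma Phi_ge0 f : locp f -> 0 <= Phi f.
Proof.
move=> lf; rewrite -Phi0; apply: Phi_le; [exact: locp0|exact: lf|].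
by apply: aeW => x; case: lf.
Qed.

(** Otherwise each n has a v_n that is small on X_n with Phi v_n > n, and the common bound V of
    [exists_locp_bound] would satisfy Phi V > n for all n. *)
Let weak_bound : exists n, forall f, locp f ->
  (powint mu p (X n) f <= (1 / (2 ^ n.+1)%:R)%:E)%E -> Phi f <= n%:R.
Proof.
apply: contrapT => /forallNP H.
have /choice[v vP] n : exists f, [/\ locp f,
    (powint mu p (X n) f <= (1 / (2 ^ n.+1)%:R)%:E)%E & n%:R < Phi f].
  have /existsNP[f] := H n; move=> /not_implyP[lf] /not_implyP[fn] /negP.
  by rewrite -ltNge => nf; exists f.
have v0 n x : 0 <= v n x by have [[]] := vP n.
have mv n : measurable_fun setT (v n) by have [[]] := vP n.
have [k|V Vloc vV] := exists_locp_bound (mu := mu) mX X_cover p1 mv v0.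
  (* The first k terms are finite as v_n is in [locp]; for n >= k, X_k lies inside X_n, so the n-th
     term is at most 2 ^ -(n+1). *)
  rewrite (nneseries_split 0 k); last by move=> *; exact: powint_ge0.
  apply: lte_add_pinfty.
    by apply: lte_sum_pinfty => n _; have [[_ _]] := vP n; exact.
  rewrite add0n eseries_cond; apply: (@le_lt_trans _ _ 1%:E); last exact: ltry.
  apply: le_trans (epsilon_trick0 (fun n => true && (k <= n)%N) ler01).
  apply: lee_nneseries => [n _ _|n /= kn]; first exact: powint_ge0.
  have [_ + _] := vP n; apply: le_trans.
  apply: ge0_subset_integral => //; last exact: ndX.
  - exact: measurable_powint.
  - by move=> x _; rewrite lee_fin powR_ge0.
have := archi_boundP (Phi_ge0 Vloc); set N := Num.bound _.
have [lv _ vN] := vP N.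
by rewrite ltNge (le_trans (ltW vN))// Phi_le.
Qed.

(** Homogeneity upgrades [weak_bound]: f is rescaled until \int_{X n} f ^ p equals the threshold e.
    In particular Phi f = 0 when f vanishes on [X n]. *)
Lemma Phi_bounded : exists n, exists2 C, 0 <= C & forall f, locp f ->
  ((Phi f `^ p)%:E <= C%:E * powint mu p (X n) f)%E.
Proof.
have [n nP] := weak_bound; set e : R := 1 / _ in nP.
have e0 : 0 < e by rewrite divr_gt0// ltr0n expn_gt0.
exists n, (n%:R `^ p / e); first by rewrite divr_ge0 ?powR_ge0// ltW.
move=> f lf; have [mf f0 foo] := lf.
have [I If] : exists I : R, powint mu p (X n) f = I%:E.
  exists (fine (powint mu p (X n) f)); rewrite fineK// ge0_fin_numE//.
  exact: powint_ge0.
have I0 : 0 <= I by rewrite -lee_fin -If powint_ge0.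
have key c : 0 <= c -> c `^ p * I <= e -> c * Phi f <= n%:R.
  move=> c0 ce; rewrite -PhiZ; [|exact: c0|exact: lf].
  apply: nP; first exact: locpZ.
  by rewrite powintZ// If -EFinM lee_fin.
rewrite If -EFinM lee_fin; have [I_eq0|I_neq0] := eqVneq I 0.
  (* If the integral is 0, every multiple of f meets the threshold, so c * Phi f <= n for all c >=
     0; the factor (n + 1) / Phi f refutes Phi f > 0. *)
  suff -> : Phi f = 0 by rewrite powR0 ?gt_eqF// I_eq0 mulr0.
  apply/le_anti; rewrite (Phi_ge0 lf) andbT leNgt; apply/negP => Pf0.
  have := key ((n%:R + 1) / Phi f); rewrite divfK ?gt_eqF//.
  rewrite I_eq0 mulr0 => /(_ _ (ltW e0)) h.
  have := h (divr_ge0 (addr_ge0 (ler0n _ _) ler01) (ltW Pf0)).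
  by rewrite leNgt ltrDl ltr01.
have {I0 I_neq0} I0 : 0 < I by rewrite lt_def I_neq0.
pose c := (e / I) `^ p^-1.
have cE : c `^ p = e / I.
  by rewrite /c -powRrM mulVf ?gt_eqF// powRr1// ltW// divr_gt0.
have := key c (powR_ge0 _ _); rewrite cE divfK ?gt_eqF// => /(_ (lexx _)) cM.
have : (c * Phi f) `^ p <= n%:R `^ p.
  by apply: ge0_ler_powR; rewrite ?nnegrE ?(ltW p0)// mulr_ge0 ?powR_ge0 ?(Phi_ge0 lf).
rewrite powRM ?powR_ge0 ?(Phi_ge0 lf)// cE -ler_pdivlMl ?divr_gt0//.
by move=> /le_trans; apply; rewrite invf_div mulrC mulrA mulrAC.
Qed.

(** Dominated convergence applies to u_k ^ p on the single set [X n] of [Phi_bounded], and the bound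
    transfers it to Phi. This continuity gives sigma-additivity and the passage from simple
    functions to all of [locp]. *)
Lemma Phi_cvg0 f (u : (T -> R)^nat) : locp f ->
  (forall k, measurable_fun setT (u k)) -> (forall k x, 0 <= u k x <= f x) ->
  (forall x, u ^~ x @ \oo --> (0 : R)) -> Phi \o u @ \oo --> (0 : R).
Proof.
move=> lf mu_ uf u0; have [n [C C0 PhiC]] := Phi_bounded.
have [mf f0 foo] := lf.
have lu k : locp (u k) by apply: locp_le lf => // x; have /andP[] := uf k x.
have [| | | | |_ _ cvg] := @dominated_convergence _ _ _ mu _ (mX n)
  (fun k x => (u k x `^ p)%:E) (cst 0)%E (fun x => (f x `^ p)%:E).
- by move=> k; exact: measurable_powint.
- exact: measurable_cst.
- apply: aeW => x _; apply/cvg_EFin; first exact: nearW.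
  by apply: cvgn_powR0 => // k; have /andP[] := uf k x.
- apply/integrableP; split; first exact: measurable_powint.
  by under eq_integral do rewrite gee0_abs ?lee_fin ?powR_ge0//; exact: foo.
- apply: aeW => x k _; have /andP[u0x ufx] := uf k x.
  rewrite gee0_abs ?lee_fin ?powR_ge0//.
  by apply: ge0_ler_powR; rewrite ?nnegrE ?(ltW p0).
rewrite integral0 in cvg.
have Pp : (fun k => (Phi (u k) `^ p)%:E) @ \oo --> 0%E.
  apply: (@squeeze_cvge _ _ _ _ (cst 0%E) _ (fun k => C%:E * powint mu p (X n) (u k))%E).
  - by apply: nearW => k; rewrite lee_fin powR_ge0; exact: PhiC (lu k).
  - exact: cvg_cst.
  - by rewrite -(mule0 C%:E); apply: cvgeZl.
have {Pp} /(cvgn_powR0 (r := p^-1)) : (fun k => Phi (u k) `^ p) @ \oo --> (0 : R).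
  by case/fine_cvgP : Pp.
rewrite invr_gt0 => /(_ p0 (fun k => powR_ge0 _ _)).
by under eq_fun do rewrite -powRrM mulfV ?gt_eqF// powRr1 ?(Phi_ge0 (lu _))//.
Qed.

(** * The measure A |-> Phi (W 1_A) and the density of Phi *)

Section weight.
Variable W : T -> R.
Hypothesis W_locp : locp W.

(** Indicators alone need not be in [locp], because mu (X k) may be infinite; the factor W brings
    them in. *)
Definition wcut (A : set T) x : R := W x * \1_A x.

Lemma wcut_locp A : measurable A -> locp (wcut A).
Proof.
move=> mA; have [mW W0 _] := W_locp; apply: locp_le W_locp => // [|x|x].
- by apply: measurable_funM => //; exact: measurable_indic.
- by rewrite mulr_ge0.
- by rewrite /wcut indicE; case: (x \in A); rewrite ?mulr1// mulr0.
Qed.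

Lemma Phi_wcutU A B : measurable A -> measurable B -> A `&` B = set0 ->
  Phi (wcut (A `|` B)) = Phi (wcut A) + Phi (wcut B).
Proof.
move=> mA mB AB0; rewrite -PhiD; [|exact: wcut_locp..].
congr Phi; apply/funext => x; rewrite /wcut/= !indicE in_setU -mulrDr -natrD.
have : ~ (A `&` B) x by rewrite AB0.
have [/set_mem Ax|_] := boolP (x \in A); have [/set_mem Bx|_] := boolP (x \in B) => //.
by case.
Qed.

(** This evaluates Phi on W times a simple function: s will list its values and [A y] will be the
    level set of y. Domination by (\sum_y y) W keeps the combination in [locp]. *)
Lemma Phi_sum_wcut (s : seq R) (A : R -> set T) : {in s, forall y : R, 0 <= y} ->
  (forall y, measurable (A y)) ->
  locp (fun x => \sum_(y <- s) y * wcut (A y) x) /\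
  Phi (fun x => \sum_(y <- s) y * wcut (A y) x) = \sum_(y <- s) y * Phi (wcut (A y)).
Proof.
move=> s0 mA; have [mW W0 _] := W_locp.
have lc (t : seq R) : {in t, forall y : R, 0 <= y} ->
    locp (fun x => \sum_(y <- t) y * wcut (A y) x).
  move=> t0; have lW := locpZ (a := \sum_(y <- t) y) mX _ W_locp.
  apply: locp_le (lW _) => //.
  - by apply: measurable_sum => y; apply: measurable_funM => //; have [] := wcut_locp (mA y).
  - move=> x; rewrite big_seq sumr_ge0// => y yt.
    by apply: mulr_ge0; [exact: t0|have [_ + _] := wcut_locp (mA y); exact].
  - move=> x; rewrite mulr_suml big_seq [leRHS]big_seq ler_sum// => y yt.
    apply: ler_wpM2l; first exact: t0.
    rewrite /wcut indicE.
    by case: (x \in A y); rewrite ?mulr1// mulr0.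
  - by rewrite big_seq sumr_ge0.
split; first exact: lc.
elim: s s0 => [|y s IH] s0.
  by rewrite big_nil -[RHS]Phi0; congr Phi; apply/funext => x; rewrite big_nil.
have s0' : {in s, forall y : R, 0 <= y} by move=> z zs; rewrite s0// inE zs orbT.
have y0 : 0 <= y by rewrite s0// mem_head.
rewrite big_cons -(IH s0') -PhiZ; [|exact: y0|exact: wcut_locp].
rewrite -PhiD; [|exact: (locpZ mX y0 (wcut_locp (mA y)))|exact: lc].
by congr Phi; apply/funext => x; rewrite big_cons.
Qed.

(* The maximum only matters for non-measurable A. *)
Definition wcut_measure (A : set T) : \bar R := (Num.max 0 (Phi (wcut A)))%:E.

Lemma wcut_measureE A : measurable A -> wcut_measure A = (Phi (wcut A))%:E.
Proof.
move=> mA; congr EFin; apply: max_r; apply: Phi_ge0; exact: wcut_locp.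
Qed.

Let wcut_measure0 : wcut_measure set0 = 0%E.
Proof.
rewrite wcut_measureE// -[RHS]/(0%:E) -Phi0; congr (Phi _)%:E.
by apply/funext => x; rewrite /wcut indic0 mulr0.
Qed.

Let wcut_measure_ge0 A : (0 <= wcut_measure A)%E.
Proof. by rewrite lee_fin le_max lexx. Qed.

(** A partial sum differs from the full value by Phi (W 1_{Z n}), where the tails [Z n] decrease to
    the empty set; [Phi_cvg0], with W as dominating function, sends this to 0. *)
Let wcut_measure_sigma_additive : semi_sigma_additive wcut_measure.
Proof.
move=> F mF tF mUF; pose U n := \big[setU/set0]_(i < n) F i.
have mU n : measurable (U n) by exact: bigsetU_measurable.
have sumE n : \sum_(0 <= i < n) Phi (wcut (F i)) = Phi (wcut (U n)).
  elim: n => [|n IH].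
    rewrite big_geq// /U big_ord0 -[LHS]Phi0; congr Phi.
    by apply/funext => x; rewrite /wcut indic0 mulr0.
  have -> : U n.+1 = U n `|` F n by rewrite /U big_ord_recr.
  rewrite big_nat_recr//= IH Phi_wcutU//.
  rewrite /U setIC -bigcup_mkord; apply/seteqP; split=> // x [Fnx [i /= iltn Fix]].
  by have := tF n i I I (ex_intro _ x (conj Fnx Fix)) => ni; move: iltn; rewrite -ni ltnn.
pose Z n := \bigcup_n F n `\` U n.
have mZ n : measurable (Z n) by exact: measurableD.
have UZ n : Phi (wcut (\bigcup_n F n)) - Phi (wcut (Z n)) = Phi (wcut (U n)).
  apply/eqP; rewrite subr_eq -Phi_wcutU//; last by rewrite /Z setDIK.
  by rewrite /Z setDUK//; exact: bigsetU_bigcup.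
rewrite wcut_measureE//.
rewrite (_ : (fun n => _) =
    (fun n => (Phi (wcut (\bigcup_n F n)) - Phi (wcut (Z n)))%:E)); last first.
  apply/funext => n; rewrite UZ -sumE -sumEFin.
  by apply: eq_bigr => i _; rewrite wcut_measureE.
apply/cvg_EFin; first exact: nearW.
rewrite -[X in _ --> X]subr0; apply: cvgB; first exact: cvg_cst.
apply: (Phi_cvg0 W_locp).
- by move=> k; have [] := wcut_locp (mZ k).
- move=> k x; have [_ /(_ x) -> _] := wcut_locp (mZ k) => /=.
  have [_ W0 _] := W_locp.
  by rewrite /wcut indicE; case: (x \in Z k); rewrite ?mulr1// mulr0.
- move=> x; have [[i _ Fx]|nFx] := pselect ((\bigcup_n F n) x).
    apply/cvgrPdist_lt => e e0; near=> n.
    rewrite /wcut indicE memNset ?mulr0 ?subrr ?normr0//= => -[_]; apply.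
    rewrite /U -bigcup_mkord; exists i => //=; near: n; exact: nbhs_infty_gt.
  rewrite (_ : (fun n => _) = cst 0); first exact: cvg_cst.
  by apply/funext => n; rewrite /wcut indicE memNset ?mulr0// => -[].
Unshelve. all: by end_near. Qed.

HB.instance Definition _ := isMeasure.Build _ _ _ wcut_measure
  wcut_measure0 wcut_measure_ge0 wcut_measure_sigma_additive.
HB.instance Definition _ := Measure_isFinite.Build _ _ _ wcut_measure
  (fun A _ => erefl : wcut_measure A \is a fin_num).

Lemma wcut_measure_dominates : wcut_measure `<< mu.
Proof.
move=> N muN A mA AN; rewrite wcut_measureE//; congr EFin; apply/le_anti.
rewrite Phi_ge0 ?andbT; last exact: wcut_locp.
rewrite -Phi0; apply: Phi_le; [exact: wcut_locp|exact: locp0|].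
exists A; split=> //; first exact: muN.
move=> x /=; apply: contra_notP => nAx.
by rewrite /wcut indicE memNset// mulr0.
Qed.

Import HBNNSimple.

(** For simple h this is [Phi_sum_wcut]. Increasing simple approximations u_n of h pass to the limit
    by monotone convergence on the left, and by [Phi_cvg0] applied to f - W u_n on the right. *)
Lemma integral_wcut_measure (f h : T -> R) : locp f -> measurable_fun setT h ->
  (forall x, 0 <= h x) -> (forall x, W x * h x = f x) ->
  (\int[wcut_measure]_x (h x)%:E = (Phi f)%:E)%E.
Proof.
move=> lf mh h0 Wh; have [mW W0 _] := W_locp.
have mhE : measurable_fun setT (EFin \o h) by exact/measurable_EFinP.
pose u := nnsfun_approx measurableT mhE.
have hE0 x : setT x -> (0 <= (EFin \o h) x)%E by rewrite lee_fin.
have uh x : EFin \o u ^~ x @ \oo --> (h x)%:E.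
  exact: (@cvg_nnsfun_approx _ _ _ _ measurableT _ mhE hE0 x).
have ndu x : nondecreasing_seq (u ^~ x).
  by move=> m n mn; have /lefP := nd_nnsfun_approx measurableT mhE mn; exact.
have leu n x : u n x <= h x.
  have /fine_cvgP[_ uhx] := uh x.
  rewrite -(cvg_lim (@Rhausdorff R) uhx).
  by apply: (nondecreasing_cvgn_le (ndu x)); apply/cvg_ex; exists (h x).
pose v n x := W x * u n x.
have mv n : measurable_fun setT (v n) by exact: measurable_funM.
have vf n x : 0 <= v n x <= f x.
  by rewrite mulr_ge0//= -Wh ler_wpM2l.
have lv n : locp (v n) by apply: locp_le lf => // x; have /andP[] := vf n x.
have intE n : (\int[wcut_measure]_x (u n x)%:E = (Phi (v n))%:E)%E.
  rewrite integralT_nnsfun sintegralE fsbig_finite//=.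
  under eq_bigr do rewrite wcut_measureE// -EFinM.
  rewrite sumEFin.
  have [||_ <-] := @Phi_sum_wcut
    (finmap.enum_fset (fset_set (range (u n)))) (fun y => u n @^-1` [set y]).
  - by move=> y; rewrite in_fset_set// inE => -[x _ <-].
  - by move=> y; exact: measurable_sfunP.
  congr (Phi _)%:E; apply/funext => x; rewrite /v fimfunE fsbig_finite//= mulr_sumr.
  by apply: eq_bigr => y _; rewrite /wcut mulrCA.
have cvg1 : (fun n => (Phi (v n))%:E) @ \oo --> (\int[wcut_measure]_x (h x)%:E)%E.
  rewrite (_ : (\int[wcut_measure]_x (h x)%:E =
      \int[wcut_measure]_x lim ((EFin \o u n) x @[n --> \oo]))%E); last first.
    by apply: eq_integral => x _; apply/esym/cvg_lim => //; exact: uh.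
  under eq_fun do rewrite -intE.
  apply: cvg_monotone_convergence => //.
  - by move=> n; exact/measurable_EFinP.
  - by move=> n x _; rewrite lee_fin.
  - by move=> x _ m n mn; rewrite lee_fin; exact: ndu.
have cvgR : (fun n => Phi (v n)) @ \oo --> Phi f.
  pose w n x := f x - v n x.
  have wf n x : 0 <= w n x <= f x.
    by have /andP[? ?] := vf n x; rewrite subr_ge0 gerBl; apply/andP.
  have [mf _ _] := lf.
  have mw n : measurable_fun setT (w n) by exact: measurable_funB.
  have lw n : locp (w n) by apply: locp_le lf => // x; have /andP[] := wf n x.
  have PhiE n : Phi (v n) = Phi f - Phi (w n).
    apply/eqP; rewrite eq_sym subr_eq -PhiD; [|exact: lv|exact: lw].
    apply/eqP; congr Phi.
    by apply/funext => x; rewrite /w/= addrC subrK.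
  rewrite (_ : (fun n => _) = (fun n => Phi f - Phi (w n))); last exact/funext.
  rewrite -[X in _ --> X]subr0; apply: cvgB; first exact: cvg_cst.
  apply: (Phi_cvg0 lf) => // x.
  rewrite -(subrr (f x)) /w; apply: cvgB; first exact: cvg_cst.
  rewrite -Wh /v; apply: cvgMr; have /fine_cvgP[_] := uh x; exact.
have cvg2 : (fun n => (Phi (v n))%:E) @ \oo --> (Phi f)%:E.
  by apply/cvg_EFin; [exact: nearW|exact: cvgR].
exact: cvg_unique cvg1 cvg2.
Qed.

Hypothesis W_gt0 : \forall x \ae mu, 0 < W x.
Hypothesis mu_sigma_finite : sigma_finite [set: T] mu.

Lemma Phi_density : exists g : T -> R, [/\ measurable_fun setT g,
  forall x, 0 <= g x &
  forall f, locp f -> (Phi f)%:E = (\int[mu]_x (g x * f x)%:E)%E].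
Proof.
have [mW W0 _] := W_locp.
pose fin1 := isSFinite.Build _ _ _ (Measure.sort mu)
  (sfinite_measure_sigma_finite mu_sigma_finite).
pose fin2 := isSigmaFinite.Build _ _ _ (Measure.sort mu) mu_sigma_finite.
pose la : {sigma_finite_measure set T -> \bar R} :=
  HB.pack (Measure.sort mu) fin1 fin2.
have nula : wcut_measure `<< la by exact: wcut_measure_dominates.
pose G := Radon_Nikodym_SigmaFinite.f wcut_measure la.
have G0 := Radon_Nikodym_SigmaFinite.f_ge0 nula.
have Gfin := Radon_Nikodym_SigmaFinite.f_fin_num nula.
have mG : measurable_fun setT G.
  exact: measurable_int (Radon_Nikodym_SigmaFinite.f_integrable nula).
have mV : measurable_fun setT (fun x => (W x)^-1).
  under eq_fun do rewrite -powR_inv1//.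
  exact: (@measurableT_comp _ _ _ _ _ _ (@powR R ^~ (-1))).
exists (fun x => fine (G x) * (W x)^-1); split.
- by apply: measurable_funM => //; exact: measurableT_comp.
- by move=> x; rewrite mulr_ge0 ?fine_ge0 ?invr_ge0.
move=> f lf; have [mf f0 _] := lf.
(* Where W = 0 the inverse is 0, so W h vanishes there and equals f only a.e.; Phi does not see the
   difference. *)
pose h x := f x * (W x)^-1; pose f' x := W x * h x.
have mh : measurable_fun setT h by exact: measurable_funM.
have h0 x : 0 <= h x by rewrite mulr_ge0 ?invr_ge0.
have ff' : \forall x \ae mu, f' x = f x.
  by apply: filterS W_gt0 => x Wx; rewrite /f' /h mulrC divfK ?gt_eqF.
have lf' : locp f'.
  apply: locp_le lf => // [|x|x]; first exact: measurable_funM.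
    by rewrite mulr_ge0.
  rewrite /f' /h; have [->|Wx] := eqVneq (W x) 0; first by rewrite mul0r.
  by rewrite mulrC divfK.
have -> : Phi f = Phi f'.
  by apply/le_anti/andP; split; apply: Phi_le => //; apply: filterS ff' => x ->.
rewrite -(integral_wcut_measure lf' mh h0)//.
rewrite -(Radon_Nikodym_SigmaFinite.change_of_variables nula)//; last exact/measurable_EFinP.
apply: eq_integral => x _; rewrite -[in LHS](fineK (Gfin x)) -EFinM /h.
by rewrite mulrC mulrAC mulrA.
Qed.

End weight.

(** The density g' of Phi is cut down to the set [X n] of [Phi_bounded]. The same bound then
    controls its norm: uniformly over truncations if q < +oo, and as g <= C a.e. if q = +oo. *)
Lemma Phi_repr (q : \bar R) : sigma_finite [set: T] mu ->
    (1 <= q)%E -> (p%:E^-1 + q^-1 = 1)%E ->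
  exists (n : nat) (g : T -> R),
  [/\ measurable_fun setT g, forall x, ~ X n x -> g x = 0,
  finite_norm mu q g &
  forall f, locp f -> (Phi f)%:E = (\int[mu]_x (g x * f x)%:E)%E].
Proof.
move=> mu_sf q1 pq.
have [W W_locp W_gt0] := exists_locp_gt0 mX X_cover p1 mu_sf.
have [mW W0 _] := W_locp.
have [g' [mg' g'0 Phig']] := Phi_density W_locp W_gt0 mu_sf.
have [n [C C0 PhiC]] := Phi_bounded.
have Xn1 : measurable_fun setT (\1_(X n) : T -> R) by exact: measurable_indic.
pose g x := g' x * \1_(X n) x.
have mg : measurable_fun setT g by exact: measurable_funM.
have g0 x : 0 <= g x by rewrite mulr_ge0.
have gX x : ~ X n x -> g x = 0 by move=> nXx; rewrite /g indicE memNset ?mulr0.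
have Phig f : locp f -> (Phi f)%:E = (\int[mu]_x (g x * f x)%:E)%E.
  move=> lf; have [mf f0 _] := lf.
  (* [Phi_bounded] kills the part of f outside [X n], so g represents Phi as well as g' does. *)
  pose fi x := f x * \1_(X n) x; pose fo x := f x * \1_(~` X n) x.
  have lfi : locp fi.
    apply: locp_le lf => // [|x|x]; [exact: measurable_funM|by rewrite mulr_ge0|].
    by rewrite /fi indicE; case: (x \in _); rewrite ?mulr1// mulr0.
  have lfo : locp fo.
    apply: locp_le lf => // [|x|x].
    - apply: measurable_funM => //; apply: measurable_indic; exact: measurableC.
    - by rewrite mulr_ge0.
    - by rewrite /fo indicE; case: (x \in _); rewrite ?mulr1// mulr0.
  have fE : f = fi \+ fo.
    apply/funext => x; rewrite /fi /fo/= !indicE in_setC -mulrDr.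
    by case: (x \in X n); rewrite /= ?addr0 ?add0r mulr1.
  have Phifo : Phi fo = 0.
    have := PhiC _ lfo; rewrite [powint _ _ _ _](_ : _ = 0%E) ?mule0; last first.
      rewrite /powint -(integral0 mu (X n)); apply: eq_integral => x /set_mem Xx.
      by rewrite /fo indicE memNset ?mulr0 ?powR0 ?gt_eqF//= => /(_ Xx).
    rewrite lee_fin => Phi0; apply: (@powR_eq0_eq0 R _ p); apply/le_anti.
    by rewrite Phi0 powR_ge0.
  rewrite [in LHS]fE (PhiD lfi lfo) Phifo addr0 (Phig' _ lfi); apply: eq_integral => x _.
  by rewrite /fi /g mulrA mulrAC.
exists n, g; split => //.
move: pq; rewrite inver gt_eqF//; case: q q1 => [q|_|//].
  rewrite lee_fin => q1; have q0 : 0 < q by exact: lt_le_trans q1.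
  rewrite inver gt_eqF// -EFinD => -[] pq.
  have ppos : p != 0 by rewrite gt_eqF.
  have qpos : q != 0 by rewrite gt_eqF.
  have pqE : p * q = p + q.
    by rewrite -[LHS]mulr1 -pq mulrDr mulfK// [p * q]mulrC mulfK// addrC.
  have p_gt1 : 0 < p - 1.
    by rewrite subr_gt0 -invf_lt1// -pq ltrDl invr_gt0.
  have q1p1 : (q - 1) * (p - 1) = 1.
    by rewrite (_ : _ * _ = p * q - (p + q) + 1); [rewrite pqE subrr add0r|ring].
  have q1p : (q - 1) * p = q by rewrite mulrBl mul1r [q * p]mulrC pqE addrAC subrr add0r.
  (* The cut at k W puts f_k in [locp]; as k grows, f_k increases to g ^ (q - 1) wherever W > 0. *)
  pose f k x := Num.min (g x `^ (q - 1)) (k%:R * W x).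
  have mgq : measurable_fun setT (fun x => g x `^ (q - 1)).
    exact: (@measurableT_comp _ _ _ _ _ _ (@powR R ^~ (q - 1))).
  have mf k : measurable_fun setT (f k).
    by apply: measurable_minr => //; exact: measurable_funM.
  have f0 k x : 0 <= f k x by rewrite le_min powR_ge0 mulr_ge0.
  have lf k : locp (f k).
    apply: (locp_le mX p1 (mf k) (f0 k) _ (locpZ mX (ler0n _ k) W_locp)) => x.
    by rewrite ge_min lexx orbT.
  (* f_k ^ p = f_k f_k ^ (p - 1), and f_k ^ (p - 1) <= g ^ ((q - 1) (p - 1)) = g. *)
  have fp_le k x : f k x `^ p <= g x * f k x.
    rewrite -mulr_powRB1// mulrC; apply: ler_wpM2r => //.
    rewrite [leRHS](_ : _ = (g x `^ (q - 1)) `^ (p - 1)); last first.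
      by rewrite -powRrM q1p1 powRr1.
    by apply: ge0_ler_powR; rewrite ?nnegrE ?powR_ge0 ?(ltW p_gt1) ?ge_min ?lexx.
  have mfp k : measurable_fun setT (fun x => (f k x `^ p)%:E).
    exact: measurable_powint.
  (* With I = \int_{X n} f_k ^ p, [fp_le] gives I <= Phi f_k and [PhiC] gives (Phi f_k) ^ p <= C I.
     Dividing I ^ p <= C I by I > 0 bounds I uniformly in k. *)
  have bound k : (powint mu p (X n) (f k) <= (C `^ (p - 1)^-1)%:E)%E.
    have [I If] : exists I : R, powint mu p (X n) (f k) = I%:E.
      exists (fine (powint mu p (X n) (f k))); rewrite fineK// ge0_fin_numE ?powint_ge0//.
      by have [_ _] := lf k; exact.
    have I0 : 0 <= I by rewrite -lee_fin -If powint_ge0.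
    rewrite If lee_fin; have [->|I_neq0] := eqVneq I 0; first exact: powR_ge0.
    have I_gt0 : 0 < I by rewrite lt_def I_neq0.
    have mgf : measurable_fun setT (fun x => (g x * f k x)%:E).
      by apply/measurable_EFinP; exact: measurable_funM.
    have IPhi : I <= Phi (f k).
      rewrite -lee_fin -If (Phig _ (lf k)).
      apply: (@le_trans _ _ (\int[mu]_(x in X n) (g x * f k x)%:E)%E).
        apply: ge0_le_integral => //.
        - by move=> x _; rewrite lee_fin powR_ge0.
        - exact: measurable_funTS.
        - exact: measurable_funTS.
        - by move=> x _; rewrite lee_fin.
      by apply: ge0_subset_integral => // x _; rewrite lee_fin mulr_ge0.
    have : I * I `^ (p - 1) <= I * C.
      rewrite mulr_powRB1// [leRHS]mulrC -lee_fin EFinM -If.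
      apply: le_trans (PhiC _ (lf k)); rewrite lee_fin.
      by apply: ge0_ler_powR; rewrite ?nnegrE ?(ltW p0) ?(Phi_ge0 (lf k)).
    rewrite ler_pM2l// => IC.
    rewrite [leLHS](_ : _ = (I `^ (p - 1)) `^ (p - 1)^-1); last first.
      by rewrite -powRrM mulfV ?powRr1// lt0r_neq0.
    by apply: ge0_ler_powR; rewrite ?nnegrE ?powR_ge0// invr_ge0 ltW.
  have ndfp x : nondecreasing_seq (fun k => (f k x `^ p)%:E).
    move=> k l kl; rewrite lee_fin.
    apply: ge0_ler_powR; rewrite ?nnegrE ?(ltW p0)//.
    by rewrite le_min ge_min lexx/= ge_min ler_wpM2r ?orbT ?ler_nat.
  have cvgf x : cvgn (fun k => (f k x `^ p)%:E).
    exact: ereal_nondecreasing_is_cvgn (ndfp x).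
  apply/finite_norm_realP => //.
  have fg : \forall x \ae mu, X n x ->
      (`|g x| `^ q)%:E = limn (fun k => (f k x `^ p)%:E).
    apply: filterS W_gt0 => x Wx Xx; apply/esym/cvg_lim => //.
    (* The sequence is eventually constant: the minimum is g ^ (q - 1) once k >= g ^ (q - 1) / W. *)
    apply: cvg_near_cst; near=> k; congr EFin.
    rewrite /f min_l ?ger0_norm// -?powRrM ?q1p//.
    rewrite -ler_pdivrMr//; near: k; exact: nbhs_infty_ger.
  apply: (@le_lt_trans _ _ (\int[mu]_(x in X n) limn (fun k => (f k x `^ p)%:E))%E).
    rewrite (_ : (\int[mu]_x (`|g x| `^ q)%:E = \int[mu]_(x in X n) (`|g x| `^ q)%:E)%E); last first.
      rewrite [RHS]integral_mkcond; apply: eq_integral => x _; rewrite patchE.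
      case: ifPn => // /negP nX.
      by rewrite gX ?normr0 ?powR0// => Xx; apply: nX; rewrite inE.
    apply: ae_ge0_le_integral => //.
    - apply: measurable_funTS; apply/measurable_EFinP.
      apply: (@measurableT_comp _ _ _ _ _ _ (@powR R ^~ q)) => //.
      exact: measurableT_comp.
    - move=> x _; apply: lime_ge; first exact: cvgf.
      by apply: nearW => k; rewrite lee_fin powR_ge0.
    - apply: measurable_funTS.
      exact: (@emeasurable_fun_cvg _ _ _ setT (fun k x => (f k x `^ p)%:E)).
    - by apply: filterS fg => x fg Xx; rewrite fg.
  have cvg : (fun k => powint mu p (X n) (f k)) @ \oo -->
      (\int[mu]_(x in X n) limn (fun k => (f k x `^ p)%:E))%E.
    apply: cvg_monotone_convergence => //.
    - by move=> k; exact: measurable_funTS.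
    - by move=> k x _; rewrite lee_fin powR_ge0.
  rewrite -(cvg_lim _ cvg)//; apply: (@le_lt_trans _ _ (C `^ (p - 1)^-1)%:E); last exact: ltry.
  by apply: lime_le; [apply/cvg_ex; eexists; exact: cvg|exact: nearW].
(* q = +oo forces p = 1. Tested on f = W 1_{g > C}, the bound gives \int_{X n} (g - C) f <= 0 with a
   nonnegative integrand, so {g > C} is null. *)
rewrite invey adde0 => -[] /eqP; rewrite invr_eq1 => /eqP pE.
apply/finite_norm_ooP => //; exists C.
pose A := [set x | C < g x].
have mA : measurable A.
  by rewrite -[A]setTI; exact: measurable_fun_ltr.
pose f := wcut W A; have lf : locp f by exact: wcut_locp.
have [mf f0 foo] := lf.
have powE : powint mu p (X n) f = (\int[mu]_(x in X n) (f x)%:E)%E.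
  by rewrite /powint pE; apply: eq_integral => x _; rewrite powRr1.
have := PhiC _ lf; rewrite {1}pE powRr1 ?(Phi_ge0 lf)//.
have gCf x : 0 <= (g x - C) * f x.
  rewrite /f /wcut indicE; have [/set_mem/ltW Ax|_] := boolP (x \in A); last by rewrite !mulr0.
  by rewrite mulr1 mulr_ge0// subr_ge0.
have mgCf : measurable_fun setT (fun x => (g x - C) * f x).
  by apply: measurable_funM => //; exact: measurable_funB.
rewrite (Phig _ lf) (_ : (\int[mu]_x (g x * f x)%:E =
    \int[mu]_(x in X n) ((g x - C) * f x)%:E + C%:E * powint mu p (X n) f)%E); last first.
  rewrite powE -ge0_integralZl//; last 2 first.
  - by apply: measurable_funTS; apply/measurable_EFinP.
  - by move=> x _; rewrite lee_fin.
  rewrite -ge0_integralD//.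
  - rewrite [RHS]integral_mkcond; apply: eq_integral => x _; rewrite patchE.
    case: ifPn => [_|/negP nX].
      by rewrite -EFinM -EFinD mulrBl subrK.
    by rewrite gX ?mul0r// => Xx; apply: nX; rewrite inE.
  - by move=> x _; rewrite lee_fin.
  - by apply: measurable_funTS; apply/measurable_EFinP.
  - by move=> x _; rewrite -EFinM lee_fin mulr_ge0.
  - by apply/measurable_funTS/measurable_EFinP; exact: measurable_funM.
have CIfin : (C%:E * powint mu p (X n) f)%E \is a fin_num.
  by rewrite fin_numM// ge0_fin_numE ?foo// powint_ge0.
rewrite -leeBrDr// subee//.
move=> int_le0.
have /ae_eq_integral_abs : (\int[mu]_(x in X n) `|((g x - C) * f x)%:E| = 0)%E.
  apply/le_anti/andP; split; last exact: integral_ge0.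
  by under eq_integral do rewrite gee0_abs ?lee_fin//.
move=> /(_ (mX n)) h.
have {h} : ae_eq mu (X n) (fun x => ((g x - C) * f x)%:E) (cst 0%E).
  by apply: h; apply: measurable_funTS; apply/measurable_EFinP.
apply: filterS2 W_gt0 => x Wx h; rewrite ger0_norm//.
have [Xx|/gX ->//] := pselect (X n x).
rewrite leNgt; apply/negP => Ax.
have [] := h Xx; rewrite /f /wcut indicE mem_set// mulr1 => /eqP.
by rewrite mulf_eq0 subr_eq0 !gt_eqF.
Unshelve. all: by end_near. Qed.

End positive_functional.

(** * The lattice isomorphism *)

(** Bipositivity makes S an order embedding, hence injective. As S is onto, every bound in F is an
    image, so joins and meets, which the order determines, are preserved. *)
Lemma lattice_isomorphism_bipositive (R : realType) (E F : vectorLatticeType R)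
    (S : E -> F) : linear S -> (forall y, exists x, S x = y) ->
  (forall x, (0 <= S x) = (0 <= x)) -> lattice_isomorphism S.
Proof.
move=> lS surjS S0.
have SB x y : S (x - y) = S x - S y.
  by rewrite addrC -scaleN1r lS scaleN1r addrC.
have Sle x y : (S x <= S y) = (x <= y).
  by rewrite -vl_subr_ge0 -SB S0 vl_subr_ge0.
have injS : injective S by move=> x y xy; apply/le_anti; rewrite -!Sle xy lexx.
have /choice[S' S'K] := surjS.
have SK : cancel S S' by move=> x; apply: injS; rewrite S'K.
split=> //; first by exists S'.
- move=> x y; apply/le_anti/andP; split.
    by rewrite -[X in _ <= X]S'K Sle vl_joinP -!Sle S'K vl_leUl vl_leUr.
  by rewrite vl_joinP !Sle vl_leUl vl_leUr.
- move=> x y; apply/le_anti/andP; split.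
    by rewrite vl_meetP !Sle vl_leIl vl_leIr.
  by rewrite -[X in X <= _]S'K Sle vl_meetP -!Sle S'K vl_leIl vl_leIr.
Qed.

(** * From positive functionals on L^p_loc to functionals on [locp] *)

Section locally_integrable_classes.
Context (d : measure_display) (T : measurableType d) (R : realType).
Variables (mu : {measure set T -> \bar R}) (X : (set T)^nat).
Variable mX : forall n, measurable (X n).
Variables (p : R) (p1 : (1 <= p%:E)%E).
Local Notation locp := (locp mu X p).
Local Notation Lloc := (Lspace_loc mu mX p1).
Local Notation L0 := {mfun_ mu, T >-> measurableTypeR R}.
Implicit Types (f g : T -> R) (v w : Lloc).

(** This dictionary brings the norm estimates, Minkowski's inequality among them, to [locp]. *)
Lemma locpP f : locp f <-> [/\ measurable_fun setT f, forall x, 0 <= f x &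
  forall n, finite_norm (mrestr mu (mX n)) p%:E f].
Proof.
have E n : measurable_fun setT f -> (forall x, 0 <= f x) ->
    finite_norm (mrestr mu (mX n)) p%:E f <-> (powint mu p (X n) f < +oo)%E.
  move=> mf f0; have := p1; rewrite lee_fin => p1'.
  apply: (iff_trans (finite_norm_realP _ _ p1')).
  rewrite ge0_integral_mrestr; last 2 first.
  - exact: measurable_normr_powR.
  - by move=> x; rewrite lee_fin powR_ge0.
  by under eq_integral do rewrite ger0_norm//.
by split=> -[mf f0 foo]; split => // n; apply/E.
Qed.

Lemma locpD f g : locp f -> locp g -> locp (f \+ g).
Proof.
move=> /locpP[mf f0 foo] /locpP[mg g0 goo]; apply/locpP; split=> [|x|n].
- exact: measurable_funD.
- exact: addr_ge0.
- exact: finite_normD.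
Qed.

Lemma locp_measurable f : locp f -> measurable_fun setT f.
Proof. by case. Qed.

Lemma Lspace_loc_class_subproof f (lf : locp f) :
  Lspace_loc_pred mX p%:E (L0_class mu (locp_measurable lf)).
Proof.
have /locpP[mf _ foo] := lf.
apply/(@Lspace_loc_predP _ _ _ mu X mX p%:E p1) => n.
apply: finite_norm_ae (foo n) => //; first exact: L0_measurable.
exact/ae_restr/L0_classE.
Qed.

Definition Lspace_loc_class f (lf : locp f) : Lloc :=
  LspaceLoc p1 (Lspace_loc_class_subproof lf).

Lemma Lspace_loc_classE f (lf : locp f) :
  \forall x \ae mu, (Lspace_loc_class lf x : R) = f x.
Proof. exact: L0_classE. Qed.

Lemma Lspace_locP v w : (\forall x \ae mu, (v x : R) = w x) -> v = w.
Proof. by move=> vw; apply/val_inj/L0P. Qed.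

Lemma Lspace_loc_leP v w : reflect (\forall x \ae mu, (v x : R) <= w x) (v <= w).
Proof. exact: L0_leP. Qed.

Lemma Lspace_loc_ge0P v : reflect (\forall x \ae mu, 0 <= (v x : R)) (0 <= v).
Proof.
apply: (iffP (Lspace_loc_leP _ _)); apply: filterS2 (L0_zeroE mu) => x.
  by move=> z0; rewrite z0.
by move=> z0 ?; rewrite z0.
Qed.

(** Representatives of positive classes are nonnegative only a.e., whereas [locp] asks for it
    everywhere; the positive part repairs this within the class. *)
Lemma locp_pos v : locp (fun x => Num.max (v x : R) 0).
Proof.
have mv := L0_measurable (Lspace_loc_val v).
apply/locpP; split=> [|x|n]; first exact: measurable_maxr.
  by rewrite le_max lexx orbT.
have /(Lspace_loc_predP _ p1)/(_ n) := Lspace_loc_valP v.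
apply: finite_norm_le => //; first exact: measurable_maxr.
apply: aeW => x; rewrite ger0_norm ?le_max ?lexx ?orbT//.
by rewrite ge_max normr_ge0 ler_norm.
Qed.

Lemma Lspace_loc_class_pos v : 0 <= v -> Lspace_loc_class (locp_pos v) = v.
Proof.
move=> /Lspace_loc_ge0P v0; apply: Lspace_locP.
by apply: filterS2 (Lspace_loc_classE (locp_pos v)) v0 => x -> ?; rewrite max_l.
Qed.

Section functional.
Variable phi : order_dual Lloc.
Hypothesis phi_ge0 : 0 <= phi.

(* [0] is a junk value outside the cone. *)
Definition locp_functional f : R :=
  if pselect (locp f) is left lf then phi (Lspace_loc_class lf) else 0.

Lemma locp_functionalE f (lf : locp f) :
  locp_functional f = phi (Lspace_loc_class lf).
Proof.
rewrite /locp_functional; case: pselect => // lf'.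
by congr (phi _); apply: Lspace_locP;
  apply: filterS2 (Lspace_loc_classE lf') (Lspace_loc_classE lf) => x -> ->.
Qed.

Lemma locp_functionalD f g : locp f -> locp g ->
  locp_functional (f \+ g) = locp_functional f + locp_functional g.
Proof.
move=> lf lg; have lfg := locpD lf lg.
rewrite (locp_functionalE lf) (locp_functionalE lg) (locp_functionalE lfg).
rewrite -(lfunD (order_dual_linear phi)); congr (phi _); apply: Lspace_locP.
have fgE : \forall x \ae mu,
    ((Lspace_loc_class lf + Lspace_loc_class lg : Lloc) x : R) = f x + g x.
  have := L0_addE (Lspace_loc_class lf : L0) (Lspace_loc_class lg : L0).
  by apply: filterS3 (Lspace_loc_classE lf) (Lspace_loc_classE lg) => x -> ->.
by apply: filterS2 (Lspace_loc_classE lfg) fgE => x -> ->.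
Qed.

Lemma locp_functionalZ (a : R) f : 0 <= a -> locp f ->
  locp_functional (fun x => a * f x) = a * locp_functional f.
Proof.
move=> a0 lf; have laf := locpZ mX a0 lf.
rewrite (locp_functionalE lf) (locp_functionalE laf).
rewrite -(lfunZ (order_dual_linear phi)); congr (phi _); apply: Lspace_locP.
have afE : \forall x \ae mu, ((a *: Lspace_loc_class lf : Lloc) x : R) = a * f x.
  have := L0_scaleE a (Lspace_loc_class lf : L0).
  by apply: filterS2 (Lspace_loc_classE lf) => x ->.
by apply: filterS2 (Lspace_loc_classE laf) afE => x -> ->.
Qed.

Lemma locp_functional_le f g : locp f -> locp g ->
  (\forall x \ae mu, f x <= g x) -> locp_functional f <= locp_functional g.
Proof.
move=> lf lg fg; rewrite (locp_functionalE lf) (locp_functionalE lg) -subr_ge0.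
rewrite -(lfunB (order_dual_linear phi)).
have /order_dual_leP := phi_ge0; apply; rewrite vl_subr_ge0; apply/Lspace_loc_leP.
by apply: filterS3 (Lspace_loc_classE lf) (Lspace_loc_classE lg) fg => x -> ->.
Qed.

End functional.

End locally_integrable_classes.

(** * The pairing of L^q_c with L^p_loc *)

Section Xi_duality.
Context (d : measure_display) (T : measurableType d) (R : realType).
Variables (mu : {measure set T -> \bar R}) (X : (set T)^nat).
Variable mX : forall n, measurable (X n).
Variable ndX : {homo X : m n / (m <= n)%N >-> m `<=` n}.
Variables (p : R) (q : \bar R) (p1 : (1 <= p%:E)%E) (q1 : (1 <= q)%E).
Hypothesis pq : ((p%:E)^-1 + q^-1 = 1)%E.
Local Notation Lc := (Lspace_c mu q1 ndX).
Local Notation Lloc := (Lspace_loc mu mX p1).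
Local Notation e_ := (extension0 mu mX ndX q1).
Local Notation r_ := (restriction mu mX p1).
Implicit Types (u w : Lc) (v : Lloc).

Lemma Lspace_c_supp u : exists n, \forall x \ae mu, ~ X n x -> (u x : R) = 0.
Proof. exact/asboolP/(Lspace_c_valP u). Qed.

Lemma Lspace_cP u w : (\forall x \ae mu, (u x : R) = w x) -> u = w.
Proof. by move=> uw; apply/val_inj/LspaceP. Qed.

Lemma Lspace_c_ge0P u : reflect (\forall x \ae mu, 0 <= (u x : R)) (0 <= u).
Proof.
apply: (iffP (Lspace_leP _ (Lspace_c_val u)));
  apply: filterS2 (Lspace_zeroE mu q1) => x.
  by move=> z0; rewrite z0.
by move=> z0 ?; rewrite z0.
Qed.

Lemma Lspace_c_linearE (a : R) u w :
  \forall x \ae mu, ((a *: u + w : Lc) x : R) = a * u x + w x.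
Proof. exact: (Lspace_linearE a (Lspace_c_val u) (Lspace_c_val w)). Qed.

Lemma Lspace_c_restr_subproof u n : finite_norm (mrestr mu (mX n)) q u.
Proof.
have mu_ := Lspace_measurable (Lspace_c_val u).
apply/finite_norm_mrestr => //.
apply: (@finite_norm_le _ _ _ _ _ _ (u : T -> R)) => //.
- by apply: measurable_funM => //; exact: measurable_indic.
- apply: aeW => x; rewrite normrM ler_piMr// indicE.
  by case: (x \in X n); rewrite ?normr1 ?normr0.
- exact: Lebesgue_finite.
Qed.

Definition Lspace_c_restr n u : LspaceType (mrestr mu (mX n)) q1 :=
  Lspace_class q1 (Lspace_measurable (Lspace_c_val u)) (Lspace_c_restr_subproof u n).

Lemma extension0E n (u : LspaceType (mrestr mu (mX n)) q1) :
  \forall x \ae mu, (e_ n u x : R) = u x * \1_(X n) x.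
Proof. exact: Lspace_classE. Qed.

(** Since every element of L^q_c vanishes a.e. outside some X_n, this shows that the ranges of the
    e_n exhaust L^q_c. *)
Lemma extension0_restr n u : (\forall x \ae mu, ~ X n x -> (u x : R) = 0) ->
  e_ n (Lspace_c_restr n u) = u.
Proof.
move=> u0; apply: Lspace_cP.
have /ae_mrestr := Lspace_classE q1 (Lspace_measurable (Lspace_c_val u))
  (Lspace_c_restr_subproof u n).
apply: filterS3 (extension0E (Lspace_c_restr n u)) u0 => x -> u0 uX.
rewrite indicE; have [/set_mem Xx|/negP Xx] := boolP (x \in X n).
  by rewrite mulr1 uX.
by rewrite mulr0 u0// => Xx'; apply: Xx; rewrite inE.
Qed.

Lemma measurable_pairing u v : measurable_fun setT (fun x => (u x : R) * (v x : R)).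
Proof.
apply: measurable_funM; first exact: (Lspace_measurable (Lspace_c_val u)).
exact: (L0_measurable (Lspace_loc_val v)).
Qed.

(** Off [X n] the integrand vanishes a.e., so the integral over T reduces to one over [X n]. Both
    the compatibility with e_n and the order boundedness of the pairing come from this. *)
Lemma pairing_extension n (w : LspaceType (mrestr mu (mX n)) q1) u v :
  (\forall x \ae mu, (u x : R) = w x * \1_(X n) x) ->
  \int[mu]_x ((u x : R) * (v x : R)) = Lspace_duality mu (mX n) p1 q1 pq w (r_ n v).
Proof.
move=> uw; rewrite /= /Lspace_pairing /Rintegral; congr fine.
rewrite [RHS]integral_mkcond; apply: ae_eq_integral => //.
- by apply/measurable_EFinP; exact: measurable_pairing.
- apply/(measurable_restrictT _ (mX n)).
  exact: measurable_int (Lspace_pairing_integrable pq w (r_ n v)).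
have /ae_mrestr := restrictionE n v.
apply: filterS2 uw => x -> rv _; rewrite patchE indicE.
have [/set_mem Xx|_] := boolP (x \in X n); last by rewrite mulr0 mul0r.
by rewrite mulr1 rv.
Qed.

(** v itself need not be in L^p, so the Hoelder estimate is applied to u and v 1_{X n}, where u
    vanishes a.e. outside [X n]. *)
Lemma pairing_integrable u v :
  mu.-integrable setT (EFin \o (fun x => (u x : R) * (v x : R))).
Proof.
have [n u0] := Lspace_c_supp u.
have mu_ := Lspace_measurable (Lspace_c_val u).
have mv := L0_measurable (Lspace_loc_val v).
have muv := measurable_pairing u v.
apply/integrableP; split; first exact/measurable_EFinP.
have mvi : measurable_fun setT (fun x => (v x : R) * \1_(X n) x).
  by apply: measurable_funM => //; exact: measurable_indic.
have vfin : finite_norm mu p%:E (fun x => (v x : R) * \1_(X n) x).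
  by apply/finite_norm_mrestr => //; have /(Lspace_loc_predP _ p1) := Lspace_loc_valP v; exact.
apply: le_lt_trans (finite_norm_conjugate p1 q1 pq mu_ mvi Lebesgue_finite vfin).
apply: ae_ge0_le_integral => //.
- by apply: measurableT_comp => //; exact/measurable_EFinP.
- by apply: measurableT_comp => //; apply/measurable_EFinP; exact: measurable_funM.
apply: filterS u0 => x u0 _; rewrite /= indicE.
have [_|/negP Xx] := boolP (x \in X n); first by rewrite mulr1.
by rewrite u0 ?mul0r// => Xx'; apply: Xx; rewrite inE.
Qed.

(** If u vanishes a.e. outside X_n, the functional is r_n followed by the pairing with the
    restriction of u, so it inherits linearity and order boundedness from the dual of L^p(X_n). *)
Lemma Xi_duality_subproof u :
  (fun v => \int[mu]_x ((u x : R) * (v x : R)) : R^o) \in @order_dual_pred R Lloc.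
Proof.
have [n u0] := Lspace_c_supp u.
rewrite (_ : (fun _ => _) = order_adjoint (restriction_positive mu mX p1 n)
  (Lspace_duality mu (mX n) p1 q1 pq (Lspace_c_restr n u))); last first.
  apply/funext => v; apply: pairing_extension.
  by have := extension0E (Lspace_c_restr n u); rewrite extension0_restr.
exact: order_dual_funP.
Qed.

Definition Xi_duality u : order_dual Lloc := OrderDual (Xi_duality_subproof u).

Lemma Xi_dualityE u v : Xi_duality u v = \int[mu]_x ((u x : R) * (v x : R)).
Proof. by []. Qed.

Lemma Xi_duality_extension n : Xi_duality \o e_ n =
  order_adjoint (restriction_positive mu mX p1 n) \o Lspace_duality mu (mX n) p1 q1 pq.
Proof.
apply/funext => w; apply/val_inj/funext => v.
by apply: pairing_extension; exact: extension0E.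
Qed.

Lemma Xi_duality_linear : linear Xi_duality.
Proof.
move=> a u w; apply/val_inj/funext => v.
change (\int[mu]_x (((a *: u + w : Lc) x : R) * (v x : R)) =
  a * \int[mu]_x ((u x : R) * (v x : R)) + \int[mu]_x ((w x : R) * (v x : R))).
have iu := pairing_integrable u v; have iw := pairing_integrable w v.
have iau : mu.-integrable setT (EFin \o (fun x => a * ((u x : R) * (v x : R)))).
  by have := integrableZl measurableT a iu; apply: eq_integrable => // x _; rewrite /= EFinM.
rewrite -RintegralZl// -RintegralD//.
rewrite /Rintegral; congr fine; apply: ae_eq_integral => //.
- by apply/measurable_EFinP; exact: measurable_pairing.
- by apply/measurable_EFinP; apply: measurable_funD;
    [apply: measurable_funM => //|]; exact: measurable_pairing.
by apply: filterS (Lspace_c_linearE a u w) => x -> _; rewrite mulrDl mulrA.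
Qed.

(** * Bipositivity and surjectivity of the pairing map *)

Hypothesis X_cover : \bigcup_n X n = [set: T].
Hypothesis mu_sigma_finite : sigma_finite [set: T] mu.

Lemma Xi_duality_ge0 u : (0 <= Xi_duality u) = (0 <= u).
Proof.
apply/idP/idP => [Du0|/Lspace_c_ge0P u0]; last first.
  apply/order_dual_leP => v /Lspace_loc_ge0P v0; rewrite Xi_dualityE.
  change (0 <= \int[mu]_x ((u x : R) * (v x : R))).
  apply: fine_ge0; have iuv := measurable_int _ (pairing_integrable u v).
  rewrite (ae_eq_integral (fun x => `|((u x : R) * (v x : R))%:E|)%E)//.
  - by apply: integral_ge0.
  - exact: measurableT_comp.
  - by apply: filterS2 u0 v0 => x ux vx _; rewrite gee0_abs// lee_fin mulr_ge0.
have p1' : 1 <= p by rewrite -lee_fin.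
have [W W_locp W_gt0] := exists_locp_gt0 mX X_cover p1' mu_sigma_finite.
have mu_ := Lspace_measurable (Lspace_c_val u).
pose A := [set x | (u x : R) < 0].
have mA : measurable A by rewrite -[A]setTI; exact: measurable_fun_ltr.
have lW := wcut_locp mX p1' W_locp mA.
have [_ W0 _] := W_locp.
have cut0 x : 0 <= wcut W A x by rewrite mulr_ge0.
pose v := Lspace_loc_class mX p1 lW.
have vE : \forall x \ae mu, (v x : R) = wcut W A x := Lspace_loc_classE mX p1 lW.
have v0 : 0 <= v by apply/Lspace_loc_ge0P; apply: filterS vE => x ->.
have uv_le0 : \forall x \ae mu, (u x : R) * (v x : R) <= 0.
  apply: filterS vE => x ->; rewrite /wcut indicE.
  have [/set_mem/ltW ux|_] := boolP (x \in A); last by rewrite !mulr0.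
  by rewrite mulr1 mulr_le0_ge0.
have iuv := pairing_integrable u v.
have muv := measurable_int _ iuv.
(* The integrand is nonpositive a.e., while [Du0] makes its integral nonnegative. *)
have int0 : (\int[mu]_x `|((u x : R) * (v x : R))%:E| = 0)%E.
  have intN : (\int[mu]_x `|((u x : R) * (v x : R))%:E| =
      - \int[mu]_x ((u x : R) * (v x : R))%:E)%E.
    rewrite -integralN; last exact: integrable_add_def.
    apply: ae_eq_integral => //; [exact: measurableT_comp|exact: measurableT_comp|].
    by apply: filterS uv_le0 => x h _; rewrite lee0_abs.
  apply/le_anti/andP; split; last exact: integral_ge0.
  rewrite intN oppe_le0.
  have /order_dual_leP/(_ v v0) := Du0; rewrite Xi_dualityE => h.
  have fuv := integrable_fin_num measurableT iuv.
  by rewrite -(fineK fuv) lee_fin.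
move/ae_eq_integral_abs : int0 => /(_ measurableT muv) uv0.
apply/Lspace_c_ge0P; apply: filterS3 W_gt0 vE uv0 => x Wx vx uv0.
rewrite leNgt; apply/negP => ux; have [] := uv0 I.
rewrite vx /wcut indicE mem_set// mulr1 => /eqP.
by rewrite mulf_eq0 (lt_eqF ux) gt_eqF.
Qed.

(** [Phi_repr], applied to the functional that phi induces on [locp], yields a density whose class
    is the preimage; agreement on positive vectors suffices. *)
Lemma Xi_duality_pos_surj (phi : order_dual Lloc) : 0 <= phi ->
  exists u, Xi_duality u = phi.
Proof.
move=> phi0; have p1' : 1 <= p by rewrite -lee_fin.
have [n [g [mg gX gfin gE]]] := Phi_repr mX ndX X_cover p1'
  (locp_functionalD phi) (locp_functionalZ phi) (locp_functional_le phi0)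
  mu_sigma_finite q1 pq.
have uP : Lspace_c_pred X (Lspace_class q1 mg gfin).
  by apply/asboolP; exists n; apply: filterS (Lspace_classE q1 mg gfin) => x ->; exact: gX.
exists (LspaceC ndX uP); apply: order_dualP => v v0.
rewrite -[in RHS](Lspace_loc_class_pos v0) -locp_functionalE.
rewrite -[RHS]/(fine (_)%:E) gE; last exact: locp_pos.
rewrite Xi_dualityE /Rintegral; congr fine; apply: ae_eq_integral => //.
- exact: measurable_int _ (pairing_integrable _ v).
- apply/measurable_EFinP; apply: measurable_funM => //.
  by have [] := locp_pos v.
have /Lspace_loc_ge0P v0' := v0.
apply: filterS2 (Lspace_classE q1 mg gfin) v0' => x -> vx _.
by rewrite max_l.
Qed.

Lemma Xi_duality_lattice_isomorphism : lattice_isomorphism Xi_duality.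
Proof.
apply: lattice_isomorphism_bipositive => [|phi|u].
- exact: Xi_duality_linear.
(* phi is the positive part of phi minus that of -phi, and each of the two is represented. *)
- have [u1 u1E] := Xi_duality_pos_surj (vl_pos_ge0 phi).
  have [u2 u2E] := Xi_duality_pos_surj (vl_pos_ge0 (- phi)).
  exists (-1 *: u2 + u1).
  by rewrite Xi_duality_linear u1E u2E scaleN1r addrC vl_posB.
- exact: Xi_duality_ge0.
Qed.

End Xi_duality.

Theorem theorem6p5 (d : measure_display) (T : measurableType d) (R : realType)
    (mu : {measure set T -> \bar R})
    (mu_complete : measure_is_complete mu)
    (mu_sigma_finite : sigma_finite [set: T] mu)
    (X : (set T)^nat)
    (mX : forall n, measurable (X n))
    (X_gt0 : forall n, (0 < mu (X n))%E)
    (ndX : {homo X : m n / (m <= n)%N >-> m `<=` n})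
    (X_cover : \bigcup_n X n = [set: T])
    (p : R) (q : \bar R) (p1 : (1 <= p%:E)%E) (q1 : (1 <= q)%E)
    (pq : ((p%:E)^-1 + q^-1 = 1)%E) :
  exists! Rop : Lspace_c mu q1 ndX -> order_dual (Lspace_loc mu mX p1),
    lattice_isomorphism Rop /\
    forall n, Rop \o extension0 mu mX ndX q1 n =
              order_adjoint (restriction_positive mu mX p1 n) \o
              Lspace_duality mu (mX n) p1 q1 pq.
Proof.
exists (@Xi_duality _ _ _ mu X mX ndX p q p1 q1 pq); split.
  by split; [exact: Xi_duality_lattice_isomorphism|exact: Xi_duality_extension].
(* u is e_n of its restriction to X_n for some n, and [RopE] prescribes [Rop] on the range of
   e_n. *)
move=> Rop [_ RopE]; apply/funext => u; have [n u0] := Lspace_c_supp u.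
have RXi : Xi_duality mX p1 pq \o extension0 mu mX ndX q1 n =
    Rop \o extension0 mu mX ndX q1 n.
  by rewrite RopE Xi_duality_extension.
rewrite -(extension0_restr mX u0).
exact: (congr1 (@^~ (Lspace_c_restr mX n u)) RXi).
Qed.
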